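(* Let $T$ be an exceptional Jacobi operator. Then there exist a polynomial $\tau$ with $\tau(1)\neq 0$, $\tau(-1)\neq 0$, real numbers $\alpha,\beta$, a constant $c$ and a gauge factor $\mu$ such that $\mathcal{M}(\mu)\circ T\circ \mathcal{M}(\mu^{-1})+c = T_{\mathrm{ng}}(\tau;\alpha,\beta)$, where $\mathcal{M}(f)$ denotes the multiplication operator $y\mapsto fy$. Moreover, in that case, $T_{\mathrm{ng}}(\tau;\alpha,\beta)$ is itself an exceptional Jacobi operator.
   Context: All differential operators act on functions of $x$; $D=D_x=d/dx$. A second order differential operator $T=pD^2+qD+r$ with rational coefficients $p,q,r$ is called exceptional if there is a finite set $F\subset\mathbb{N}_0$ such that for every $n\in\mathbb{N}_0\setminus F$ there is a nonzero polynomial $P$ of degree $n$ and a constant $\lambda$ with $TP=\lambda P$. It is an exceptional Jacobi operator if moreover $p(x)=x^2-1$. For $\alpha,\beta\in\mathbb{R}$ set $\eta(x;\alpha,\beta)=\frac{\alpha+1}{x-1}+\frac{\beta+1}{x+1}$, and for a polynomial $\tau$ define $$T_{\mathrm{ng}}(\tau;\alpha,\beta)=(x^2-1)\Big(D^2-2\tfrac{\tau'}{\tau}D+\tfrac{\tau''}{\tau}+\eta(x;\alpha,\beta)\big(D-\tfrac{\tau'}{\tau}\big)\Big)+2x\tfrac{\tau'}{\tau}.$$ A gauge transformation of an operator $T$ is an operator of the form $\mathcal{M}(\mu)\circ T\circ\mathcal{M}(\mu^{-1})$ for a nonzero function $\mu$; a spectral shift is the addition of a constant. *)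

(* Defs.v *)
From HB Require Import structures.
From mathcomp Require Import all_boot all_order all_algebra.
From mathcomp Require Import reals.
Set Implicit Arguments. Unset Strict Implicit. Unset Printing Implicit Defensive.
Import Order.TTheory GRing.Theory Num.Theory.
Local Open Scope ring_scope.

Section Defs.
Variable R : realType.

Notation rf := {fraction {poly R}}.

Definition rpoly (p : {poly R}) : rf := tofrac p.

Definition rX : rf := rpoly 'X.

Definition rderiv (f : rf) : rf :=
  let nd := repr f in
  let n := \n_nd in let d := \d_nd in
  rpoly (n^`() * d - n * d^`()) / rpoly (d * d).

(* A second order differential operator p D^2 + q D + r with rational
   coefficients, represented by its coefficient triple (p, q, r). *)
Record op := Op { opp2 : rf; opp1 : rf; opp0 : rf }.

Definition op_apply (T : op) (y : rf) : rf :=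
  opp2 T * rderiv (rderiv y) + opp1 T * rderiv y + opp0 T * y.

Definition op_add (S T : op) : op :=
  Op (opp2 S + opp2 T) (opp1 S + opp1 T) (opp0 S + opp0 T).
Definition op_lmul (f : rf) (T : op) : op :=
  Op (f * opp2 T) (f * opp1 T) (f * opp0 T).
Definition opD2 : op := Op 1 0 0.
Definition opD : op := Op 0 1 0.
Definition opM (f : rf) : op := Op 0 0 f.

Definition op_shift (T : op) (c : R) : op :=
  Op (opp2 T) (opp1 T) (opp0 T + rpoly c%:P).

Definition exceptional (T : op) : Prop :=
  exists F : seq nat, forall n : nat, n \notin F ->
    exists (P : {poly R}) (lam : R),
      P != 0 /\ size P = n.+1 /\ op_apply T (rpoly P) = rpoly (lam *: P).

Definition exceptional_jacobi (T : op) : Prop :=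
  opp2 T = rX ^+ 2 - 1 /\ exceptional T.

Definition eta (a b : R) : rf :=
  rpoly (a + 1)%:P / (rX - 1) + rpoly (b + 1)%:P / (rX + 1).

Definition Tng (tau : {poly R}) (a b : R) : op :=
  let t := rpoly tau in
  let g := rderiv t / t in
  let h := rderiv (rderiv t) / t in
  op_add
    (op_lmul (rX ^+ 2 - 1)
       (op_add (op_add (op_add opD2 (op_lmul (- (2%:R * g)) opD)) (opM h))
               (op_lmul (eta a b) (op_add opD (opM (- g))))))
    (opM (2%:R * rX * g)).

Definition gauge_logder (sigma : rf) (T : op) : op :=
  Op (opp2 T)
     (opp1 T - 2%:R * opp2 T * sigma)
     (opp0 T - opp1 T * sigma + opp2 T * (sigma ^+ 2 - rderiv sigma)).

End Defs.

(* Main.v *)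
Require Import Defs.
From HB Require Import structures.
From mathcomp Require Import all_boot all_order all_algebra.
From mathcomp Require Import reals complex.
From mathcomp Require Import generic_quotient fraction ring lra zify.
Import Order.TTheory GRing.Theory Num.Theory.
Local Open Scope ring_scope.
Set Implicit Arguments. Unset Strict Implicit. Unset Printing Implicit Defensive.

(** The span U of the eigenpolynomials is stable under T and has codimension at most |F|, so at every
complex point z the set I of orders of vanishing of elements of U is cofinite. Unless j is a root of the
indicial polynomial of T at z, the operator maps an element of order j to one of order j - s, where s is
fixed by the pole orders of the coefficients. Hence every residue class mod s contains a root that is a
natural number, which bounds the poles of q and r, and shows that at a pole z different from 1 and -1 the
exponents are natural numbers j and j + 2k + 1. Iterating T from order j + 2k down to order j and comparing
the next coefficients gives one linear relation on the simple pole of r, because no element of U has order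
j - 1. Take tau = prod (x - z)^(k(k+1)/2), K = prod (x - z)^(j+k) and
mu = tau / (K (x - 1)^a (x + 1)^b), with a and b the least natural exponents at 1 and -1. After the gauge by
mu, the zeroth order coefficient differs from that of T_ng by a rational function without poles that is
bounded at infinity, hence by a constant, and mu maps eigenpolynomials of T to polynomials. *)

(** * Orders of vanishing in a space of finite codimension *)

Section Span.
Variable C : fieldType.

(** The span is an inductive predicate because [E] need not come from a finite family; its elements
    are the finite linear combinations. *)
Inductive pspan (E : {poly C} -> Prop) : {poly C} -> Prop :=
| pspan0 : pspan E 0
| pspan_step a e f : E e -> pspan E f -> pspan E (a *: e + f).

Variable E : {poly C} -> Prop.

Lemma pspan_gen e : E e -> pspan E e.
Proof. by move=> Ee; rewrite -[e]scale1r -[_ *: _]addr0; apply/pspan_step/pspan0. Qed.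

Lemma pspan_lin a f g : pspan E f -> pspan E g -> pspan E (a *: f + g).
Proof.
move=> Ef Eg; elim: Ef => [|b e h Ee _ IH]; first by rewrite scaler0 add0r.
by rewrite scalerDr scalerA -addrA; apply: pspan_step.
Qed.

Lemma pspan_sum (I : finType) (v : I -> C) (u : I -> {poly C}) :
  (forall i, pspan E (u i)) -> pspan E (\sum_i v i *: u i).
Proof.
move=> Eu; elim/big_ind: _ => [|x y Ex Ey|i _]; first exact: pspan0.
  by rewrite -[x]scale1r; apply: pspan_lin.
by rewrite -[_ *: _]addr0; apply/pspan_lin/pspan0.
Qed.

Variable F : seq nat.
Hypothesis EF : forall n, n \notin F -> exists f : {poly C}, size f = n.+1 /\ E f.

(** Leading terms are cancelled one at a time, by a generator when the degree lies outside [F] and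
    by a monomial otherwise. So the span has codimension at most [size F]. *)
Lemma pspan_reduce g : exists (u : {poly C}) (c : 'I_(size F) -> C),
  pspan E u /\ g = u + \sum_i c i *: 'X^(nth 0%N F i).
Proof.
have [n] := ubnP (size g); elim: n => // n IH in g *; rewrite ltnS => sg.
have [->|g0] := eqVneq g 0.
  exists 0, (fun _ => 0); split; first exact: pspan0.
  by rewrite add0r big1 // => i _; rewrite scale0r.
have sg1 : (size g).-1.+1 = size g by rewrite prednK ?size_poly_gt0.
have red (h : {poly C}) (c : C) : size h = size g -> h != 0 -> c = lead_coef g / lead_coef h ->
  (size (g - c *: h)%R < n)%N.
  move=> sh h0 ->; apply: leq_trans sg.
  have lh : lead_coef h != 0 by rewrite lead_coef_eq0.
  rewrite -sg1 ltnS; apply/leq_sizeP => j.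
  rewrite leq_eqVlt => /orP[/eqP <-|lt].
    by rewrite coefB coefZ -lead_coefE -[X in h`_X.-1]sh -lead_coefE divfK ?subrr.
  by rewrite coefB coefZ !nth_default ?mulr0 ?subrr // ?sh -sg1.
case: (boolP ((size g).-1 \in F)) => [inF|/EF[h [sh Eh]]].
  have X0 : 'X^((size g).-1) != 0 :> {poly C} by rewrite monic_neq0 ?monicXn.
  have [|u [c [Eu eu]]] := IH _ (red 'X^((size g).-1) _ _ X0 erefl).
    by rewrite size_polyXn.
  have iF : (index (size g).-1 F < size F)%N by rewrite index_mem.
  set l := (_ / _) in eu.
  exists u, (fun i => c i + (if i == Ordinal iF then l else 0)); split=> //.
  under eq_bigr do rewrite scalerDl.
  rewrite big_split /= addrA -eu (bigD1 (Ordinal iF)) //= eqxx nth_index //.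
  by rewrite big1 ?addr0 ?subrK // => i /negPf ->; rewrite scale0r.
have h0 : h != 0 by rewrite -size_poly_gt0 sh.
rewrite sg1 in sh.
have /IH[u [c [Eu eu]]] := red h _ sh h0 erefl.
set l := (_ / _) in eu.
exists (l *: h + u), c; split; first by apply: pspan_step.
by rewrite -addrA -eu addrC subrK.
Qed.

Definition pspan_order (j : nat) : Prop :=
  exists f0 : {poly C}, f0.[0] != 0 /\ pspan E ('X^j * f0).

(* The monomials involved are linearly dependent modulo the span, whose codimension is at most [size F]. *)
Lemma pspan_order_progression a s : (0 < s)%N -> exists i, pspan_order (a + s * i).
Proof.
move=> s0.
have /fin_all_exists[u /fin_all_exists[c uc]] (i : 'I_(size F).+1) : exists (u : {poly C}) (c : {ffun 'I_(size F) -> C}),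
    pspan E u /\ 'X^(a + s * i) = u + \sum_i c i *: 'X^(nth 0%N F i).
  have [u [c [Eu eu]]] := pspan_reduce 'X^(a + s * i).
  exists u, (finfun c); split=> //; rewrite eu; congr (_ + _).
  by apply: eq_bigr => j _; rewrite ffunE.
pose M := \matrix_(i, j) c i j.
(* A matrix with one more row than columns has a nonzero left kernel. *)
have kM : kermx M != 0.
  by rewrite -mxrank_eq0 mxrank_ker -lt0n subn_gt0 (leq_ltn_trans (rank_leq_col _)).
pose v := nz_row (kermx M).
have v0 : v != 0 by rewrite nz_row_eq0.
have vM : v *m M = 0 by apply/sub_kermxP/nz_row_sub.
have Ev : pspan E (\sum_i v 0 i *: 'X^(a + s * i)).
  suff -> : \sum_i v 0 i *: 'X^(a + s * i) = \sum_i v 0 i *: u i.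
    by apply: pspan_sum => i; case: (uc i).
  under eq_bigr => i _ do rewrite (proj2 (uc i)) scalerDr scaler_sumr.
  rewrite big_split /= exchange_big /= [X in _ + X]big1 ?addr0 // => j _.
  under eq_bigr do rewrite scalerA.
  rewrite -scaler_suml; have := congr1 (fun A : 'M__ => A 0 j) vM.
  rewrite !mxE => e; rewrite (_ : \sum_i _ = 0) ?scale0r // -[RHS]e.
  by apply: eq_bigr => i _; rewrite mxE.
have [i1 vi1] : exists i, v 0 i != 0.
  by apply/existsP; apply: contra_neqT v0 => /existsPn vz; apply/rowP => i;
    apply/eqP; rewrite mxE; apply: contraNT (vz i) => ->.
(* The least index with a nonzero coefficient gives the order of the combination; the truncated
   difference [i - i0] is then exact wherever the coefficient is nonzero. *)
have [i0 vi0 mi0] := @arg_minnP _ i1 (fun i => v 0 i != 0) (fun i => nat_of_ord i) vi1.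
exists i0, (\sum_i v 0 i *: 'X^(s * (i - i0))); split.
  rewrite horner_sum (bigD1 i0) //= big1 => [|i ne].
    by rewrite addr0 subnn muln0 !hornerE.
  have [->|/mi0 le] := eqVneq (v 0 i) 0; first by rewrite scale0r horner0.
  rewrite hornerZ hornerXn expr0n muln_eq0 subn_eq0.
  suff -> : (i <= i0)%N = false by rewrite orbF (gtn_eqF s0) mulr0.
  by apply: contraNF ne => le2; apply/eqP/val_inj/anti_leq; rewrite /= le2.
suff -> : 'X^(a + s * i0) * (\sum_i v 0 i *: 'X^(s * (i - i0))) = \sum_i v 0 i *: 'X^(a + s * i) by [].
rewrite mulr_sumr; apply: eq_bigr => i _.
have [->|/mi0 le] := eqVneq (v 0 i) 0; first by rewrite !scale0r mulr0.
by rewrite -scalerAr -exprD -addnA -mulnDr subnKC.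
Qed.

End Span.

(** Subtracting [s] cannot go on forever, so the descent from [j] ends in [Z], and it never leaves
    the residue class. In the application [I] holds the orders of vanishing and [Z] the
    exponents. *)
Lemma order_descent (I Z : nat -> Prop) (s : nat) :
  (0 < s)%N -> (forall j, Z j \/ ~ Z j) ->
  (forall j, I j -> ~ Z j -> (s <= j)%N /\ I (j - s)%N) ->
  forall j, I j -> exists j', [/\ (j' <= j)%N, I j', Z j' & j' = j %[mod s]].
Proof.
move=> s0 dZ st j; have [n] := ubnP j; elim: n => // n IH in j *; rewrite ltnS => jn Ij.
have [Zj|nZ] := dZ j; first by exists j.
have [sj Ij'] := st _ Ij nZ.
have [|j' [le Ij2 Zj' mj]] := IH _ _ Ij'; first by lia.
exists j'; split => //; first by lia.
by rewrite mj -[in RHS](subnK sj) modnDr.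
Qed.

(** * Operators near the origin *)

Section PowersOfX.
Variable C : fieldType.
Implicit Types (f g P Q S : {poly C}).

Lemma dvdXP n f : reflect (exists g, f = 'X^n * g) ('X^n %| f).
Proof.
apply: (iffP idP) => [/dvdpP[g ->]|[g ->]]; first by exists g; rewrite mulrC.
by rewrite dvdp_mulr.
Qed.

Lemma horner0_mulX f : f.[0] = 0 -> exists g, f = 'X * g.
Proof.
move=> f0; have /dvdXP : 'X^1 %| f by rewrite expr1 -['X]subr0 dvdp_XsubCl; apply/eqP.
by rewrite expr1.
Qed.

Lemma poly_order_split f : f != 0 -> exists n g, g.[0] != 0 /\ f = 'X^n * g.
Proof.
have [n] := ubnP (size f); elim: n => // n IH in f *; rewrite ltnS => sf f0.
have [/horner0_mulX[g eg]|?] := eqVneq f.[0] 0; last by exists 0%N, f; rewrite mul1r.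
have g0 : g != 0 by apply: contra_neq f0 => g0; rewrite eg g0 mulr0.
have [|m [h [h0 eh]]] := IH g _ g0.
  by apply: leq_trans sf; rewrite eg mulrC size_mulX.
by exists m.+1, h; rewrite eg eh exprS mulrA.
Qed.

Lemma coprimep_Xn n S : S.[0] != 0 -> coprimep 'X^n S.
Proof. by move=> S0; rewrite coprimep_expl // coprimep_sym coprimepX. Qed.

(** Both [P] and [S] are units at 0, so the excess order [n - m] falls on [Q]; coprimality of [S]
    with powers of ['X] justifies the division. *)
Lemma mulXn_eq m n P Q S : P.[0] != 0 -> S.[0] != 0 -> 'X^n * P = 'X^m * (S * Q) ->
  (m <= n)%N /\ exists g, Q = 'X^(n - m) * g /\ P = S * g.
Proof.
move=> P0 S0 e.
have mn : (m <= n)%N.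
  rewrite leqNgt; apply: contra P0 => lt; move: e.
  rewrite -{1}[m](subnKC (ltnW lt)) exprD -mulrA => /mulfI -> //.
    by rewrite hornerM hornerXn expr0n subn_eq0 leqNgt lt mul0r.
  by rewrite monic_neq0 ?monicXn.
move: e; rewrite -{1}[n](subnKC mn) exprD -mulrA => /mulfI e.
have {}e : 'X^(n - m) * P = S * Q by apply: e; rewrite monic_neq0 ?monicXn.
split=> //; have : 'X^(n - m) %| S * Q by rewrite -e dvdp_mulr.
rewrite Gauss_dvdpr ?coprimep_Xn // => /dvdXP[g eg]; exists g; split=> //.
by move: e; rewrite eg mulrCA => /mulfI -> //; rewrite monic_neq0 ?monicXn.
Qed.

(** The Euler operator [X d/dX] avoids the exponent [j - 1], so that [j = 0] is not a special case
    later on. *)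
Lemma mulX_deriv_Xn j f : 'X * ('X^j * f)^`() = 'X^j * (j%:R * f + 'X * f^`()).
Proof.
rewrite derivM derivXn; case: j => [|j]; first by rewrite mulr0n !mul0r !mul1r !add0r.
rewrite /= -mulr_natl exprS; ring.
Qed.

End PowersOfX.

(** * Action of an operator on orders of vanishing at the origin *)

Section EigenOperator.
Variable C : numFieldType.
Variables A B D S : {poly C}.

(** [S] is a common denominator of the coefficients of the operator, so [eqop] is [S] times the
    operator and eigenpolynomials solve the cleared equation. *)
Definition eqop (f : {poly C}) := A * f^`()^`() + B * f^`() + D * f.
Definition eigpoly (f : {poly C}) := exists lam : C, eqop f = lam *: (S * f).

Lemma span_stable f : pspan eigpoly f -> exists g, pspan eigpoly g /\ eqop f = S * g.
Proof.
elim=> [|a e h [lam el] _ [g [Eg eg]]].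
  by exists 0; split; [exact: pspan0|rewrite /eqop !raddf0 !mulr0 !addr0].
exists ((a * lam) *: e + g); split; first by apply: pspan_step => //; exists lam.
rewrite mulrDr -eg -scalerAr -scalerA -el /eqop !derivD !derivZ -!mul_polyC; ring.
Qed.

Variable F : seq nat.
Hypothesis EF : forall n, n \notin F -> exists f : {poly C}, size f = n.+1 /\ eigpoly f.

Variables (N e : nat) (A0 B0 D0 S0 : {poly C}).
Hypotheses (eA : A = 'X^N * A0) (eB : 'X * B = 'X^N * B0) (eD : 'X^2 * D = 'X^N * D0)
  (eS : S = 'X^e * S0) (S00 : S0.[0] != 0).

(** The leading term of ['X^j * f0] gets multiplied by the value at [j]. The case [A0.[0] = 0] is
    allowed, and the polynomial is then affine. *)
Definition indicial (x : C) := A0.[0] * (x * (x - 1)) + B0.[0] * x + D0.[0].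

Definition eqlow j (f0 : {poly C}) :=
  let f1 := j%:R * f0 + 'X * f0^`() in
  A0 * (j%:R * f1 + 'X * f1^`() - f1) + B0 * f1 + D0 * f0.

(** With [theta = X d/dX], the identity [X^2 d^2/dX^2 = theta^2 - theta] expresses all terms by
    [theta], and each coefficient contributes the factor ['X^N]. *)
Lemma eqop_low j f0 : 'X^2 * eqop ('X^j * f0) = 'X^(j + N) * eqlow j f0.
Proof.
have e1 := mulX_deriv_Xn j f0.
have e2 := mulX_deriv_Xn j (j%:R * f0 + 'X * f0^`()).
have e3 : 'X^2 * ('X^j * f0)^`()^`() = 'X * ('X * ('X^j * f0)^`())^`() - 'X * ('X^j * f0)^`().
  by move: ('X^j * f0)^`() => y; rewrite derivM derivX; ring.
rewrite e1 e2 in e3; rewrite /eqop !mulrDr.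
have -> : 'X^2 * (A * ('X^j * f0)^`()^`()) = A * ('X^2 * ('X^j * f0)^`()^`()) by ring.
have -> : 'X^2 * (B * ('X^j * f0)^`()) = ('X * B) * ('X * ('X^j * f0)^`()) by ring.
rewrite e3 e1 mulrA eB eD eA /eqlow exprD; ring.
Qed.

Lemma eqlow0 j f0 : (eqlow j f0).[0] = indicial j%:R * f0.[0].
Proof. by rewrite /eqlow /indicial -!polyC_natr !(hornerD, hornerN, hornerM, hornerX, hornerC); ring. Qed.

(** The factor ['X^2 * S] accounts for [e + 2] of the order [n]; the rest belongs to the image of
    [f] under the operator, which is again in the span. *)
Lemma span_image n f P : pspan eigpoly f -> 'X^2 * eqop f = 'X^n * P -> P.[0] != 0 ->
  (e + 2 <= n)%N /\ exists g, pspan eigpoly ('X^(n - (e + 2)) * g) /\ P = S0 * g.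
Proof.
move=> /span_stable[g [Eg ->]] eq P0; move: eq.
rewrite eS mulrA mulrA -exprD addnC -mulrA => /esym/(mulXn_eq P0 S00)[le [h [eh eP]]].
by split=> //; exists h; rewrite -eh.
Qed.

Hypothesis Ne : (N <= e + 1)%N.
Let s := (e + 2 - N)%N.
Let I := pspan_order eigpoly.

(** Off the indicial roots the lowest coefficient of [eqlow] survives, so the operator lowers the
    order by exactly [s]. Since the image is a polynomial, [j] cannot be smaller than [s]. *)
Lemma order_step j f0 : pspan eigpoly ('X^j * f0) -> f0.[0] != 0 -> indicial j%:R != 0 ->
  (s <= j)%N /\ exists g, pspan eigpoly ('X^(j - s) * g) /\ eqlow j f0 = S0 * g.
Proof.
move=> Ef f00 ij; have [|le [g [Eg eg]]] := span_image Ef (eqop_low j f0).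
  by rewrite eqlow0 mulf_neq0.
split; first by rewrite /s; lia.
exists g; split=> //; suff -> : (j - s = j + N - (e + 2))%N by [].
by rewrite /s; lia.
Qed.

Lemma order_exponent j : I j ->
  exists j', [/\ (j' <= j)%N, I j', indicial j'%:R = 0 & j' = j %[mod s]].
Proof.
apply: order_descent => [|i|i [f0 [f00 Ef]] /eqP ii]; first by rewrite /s; lia.
  by have [|/eqP] := eqVneq (indicial i%:R) 0; [left|right].
have [le [g [Eg eg]]] := order_step Ef f00 ii; split=> //; exists g; split=> //.
have := eqlow0 i f0; rewrite eg hornerM => /eqP.
by apply: contraTneq => ->; rewrite mulr0 eq_sym mulf_neq0.
Qed.

(** Finite codimension supplies an order in the class of [a], and the descent from it stops at an
    indicial root of the same class. *)
Lemma exponent_mod a : exists j, [/\ I j, indicial j%:R = 0 & j = a %[mod s]].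
Proof.
have s0 : (0 < s)%N by rewrite /s; lia.
have [i /order_exponent[j [_ Ij ij mj]]] := pspan_order_progression EF a s0.
by exists j; split=> //; rewrite mj addnC mulnC modnMDl.
Qed.

End EigenOperator.

(** * Exponents and the second order relation *)

Section LocalAnalysis.
Variable C : numFieldType.
Variables A B D S : {poly C}.
Variable F : seq nat.
Hypothesis EF : forall n, n \notin F -> exists f : {poly C}, size f = n.+1 /\ eigpoly A B D S f.

(** Induction on the order [N] already gained. For [N < d] the term of [A] drops out of the indicial
    polynomial, which becomes affine; two distinct roots make it zero, and one more factor ['X]
    appears. *)
Lemma pole_bound d e A0 S0 : A = 'X^d * A0 -> S = 'X^e * S0 -> S0.[0] != 0 -> (d <= e + 1)%N ->
  ('X^d %| 'X * B) && ('X^d %| 'X^2 * D).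
Proof.
move=> eA eS S00 de.
suff H N : (N <= d)%N -> ('X^N %| 'X * B) && ('X^N %| 'X^2 * D) by apply: H.
elim: N => [|N IH] Nd; first by rewrite expr0 !dvd1p.
have /andP[/dvdXP[B0 eB] /dvdXP[D0 eD]] := IH (ltnW Nd).
have eA' : A = 'X^N * ('X^(d - N) * A0) by rewrite mulrA -exprD subnKC // ltnW.
have Ne : (N <= e + 1)%N by lia.
have ex := exponent_mod EF eA' eB eD eS S00 Ne.
(* As [N < d <= e + 1], the modulus [e + 2 - N] is at least 2, so the classes of 0 and 1 are
   different. *)
have [i [_ ri mi]] := ex 0%N; have [j [_ rj mj]] := ex 1%N.
have ij : (i%:R - j%:R : C) != 0.
  rewrite subr_eq0 eqr_nat; apply/eqP => eij; move: mj; rewrite -eij mi mod0n modn_small //; lia.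
rewrite /indicial hornerM hornerXn expr0n subn_eq0 leqNgt Nd !mul0r !add0r in ri rj.
have B00 : B0.[0] = 0.
  have : B0.[0] * (i%:R - j%:R) = (B0.[0] * i%:R + D0.[0]) - (B0.[0] * j%:R + D0.[0]) by ring.
  by rewrite ri rj subrr => /eqP; rewrite mulf_eq0 (negPf ij) orbF => /eqP.
have D00 : D0.[0] = 0 by move: ri; rewrite B00 mul0r add0r.
have [B1 eB1] := horner0_mulX B00; have [D1 eD1] := horner0_mulX D00.
by rewrite eB eD eB1 eD1 !mulrA -!exprSr !dvdp_mulr.
Qed.

Section Order2.
Variables (e : nat) (A0 B0 S0 : {poly C}).
Hypotheses (eA : A = 'X^2 * A0) (eB : B = 'X * B0) (eS : S = 'X^e * S0)
  (S00 : S0.[0] != 0) (e0 : (0 < e)%N).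

Let eB' : 'X * B = 'X^2 * B0. Proof. by rewrite eB; ring. Qed.
Let Ne : (2 <= e + 1)%N. Proof. lia. Qed.
Let chi := indicial A0 B0 D.

(** The descent from the order of [f] reaches a natural exponent that is no larger, and this
    exponent is at least [j]. *)
Lemma span_min_exponent j : (forall i : nat, chi i%:R = 0 -> (j <= i)%N) ->
  forall f, pspan (eigpoly A B D S) f -> 'X^j %| f.
Proof.
move=> mj f Ef; have [->|f0] := eqVneq f 0; first exact: dvdp0.
have [n [g [g0 eg]]] := poly_order_split f0.
have In : pspan_order (eigpoly A B D S) n by exists g; rewrite -eg.
have [i [lei _ /mj ji _]] := order_exponent eA eB' (erefl ('X^2 * D)) eS S00 Ne In.
by rewrite eg -[n](subnKC (leq_trans ji lei)) exprD -mulrA dvdp_mulr.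
Qed.

Lemma exists_min_exponent : exists j : nat, chi j%:R = 0 /\
  forall f, pspan (eigpoly A B D S) f -> 'X^j %| f.
Proof.
have ex : exists j : nat, chi j%:R == 0.
  have [j [_ /eqP cj _]] := exponent_mod EF eA eB' (erefl ('X^2 * D)) eS S00 Ne 0; by exists j.
case: (ex_minnP ex) => j /eqP cj mj; exists j; split=> //.
by apply: span_min_exponent => i /eqP; apply: mj.
Qed.

End Order2.

(** * Points where the leading coefficient does not vanish *)

Section OrdinaryPoint.
Variables (A0 B0 S0 : {poly C}).
Hypotheses (eA : A = 'X^2 * A0) (eB : B = 'X * B0) (eS : S = 'X^2 * S0)
  (A00 : A0.[0] != 0) (S00 : S0.[0] != 0).
Let eB' : 'X * B = 'X^2 * B0. Proof. by rewrite eB; ring. Qed.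
Let chi := indicial A0 B0 D.

(** The operator lowers orders by 2 here, so there are natural exponents of both parities. Their
    difference is odd, and the two indicial equations determine both values. *)
Lemma exists_exponents : exists j k : nat, 
  B0.[0] = - (2 * j + 2 * k)%:R * A0.[0] /\ D.[0] = (j * (j + 2 * k + 1))%:R * A0.[0].
Proof.
have ex := exponent_mod EF eA eB' (erefl ('X^2 * D)) eS S00 isT.
have : exists i j, [/\ (i < j)%N, chi i%:R = 0, chi j%:R = 0 & odd (i + j)].
  have [i [_ ri mi]] := ex 0%N; have [j [_ rj mj]] := ex 1%N.
  have oij : odd (i + j) by lia.
  have [lt|lt|eij] := ltngtP i j; first by exists i, j.
    by exists j, i; rewrite addnC.
  by move: oij; rewrite eij; lia.
case=> i [j [ij ri rj oij]].
have [k ek] : exists k, j = (i + 2 * k + 1)%N by exists ((j - i)./2); lia.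
exists i, k; move: ri rj; rewrite /chi /indicial ek => ri rj.
have kn : ((2 * k + 1)%:R : C) != 0 by rewrite pnatr_eq0; lia.
move: ri rj; set Ei := (X in X = 0); set Ej := (X in _ -> X = 0 -> _) => ri rj.
have b0 : B0.[0] = - (2 * i + 2 * k)%:R * A0.[0].
  apply: (mulfI kn); apply/eqP; rewrite -subr_eq0; apply/eqP.
  transitivity (Ej - Ei); [rewrite /Ej /Ei; ring | by rewrite ri rj subrr].
split=> //; apply/eqP; rewrite -subr_eq0; apply/eqP.
transitivity Ei => //; rewrite /Ei b0; ring.
Qed.

Variables j1 k : nat.
Hypothesis b0E : B0.[0] = - (2 * j1 + 2 * k)%:R * A0.[0].
Hypothesis d0E : D.[0] = (j1 * (j1 + 2 * k + 1))%:R * A0.[0].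

Lemma indicial_factor x : chi x = A0.[0] * (x - j1%:R) * (x - (j1 + 2 * k + 1)%:R).
Proof. by rewrite /chi /indicial b0E d0E; ring. Qed.

Lemma indicial_eq0 (j : nat) : (chi j%:R == 0) = (j == j1) || (j == j1 + 2 * k + 1)%N.
Proof. by rewrite indicial_factor !mulf_eq0 (negPf A00) /= !subr_eq0 !eqr_nat. Qed.

Lemma span_first_exponent f : pspan (eigpoly A B D S) f -> 'X^j1 %| f.
Proof.
apply: (span_min_exponent eA eB eS S00 isT) => i /eqP.
by rewrite indicial_eq0; lia.
Qed.

(** The indicial polynomial with [A0], [B0], [D] replaced by their derivatives: the effect of the
    lowest coefficient on the next one. *)
Definition eqlow_coef1 (x : C) := A0^`().[0] * (x * (x - 1)) + B0^`().[0] * x + D^`().[0].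

Lemma eqlow1 j f0 : (eqlow A0 B0 D j f0)^`().[0] =
  chi (j%:R + 1) * f0^`().[0] + eqlow_coef1 j%:R * f0.[0].
Proof.
rewrite /eqlow /chi /indicial /eqlow_coef1 -!polyC_natr.
by rewrite !(derivD, derivN, derivM, derivX, derivC) 
 !(hornerD, hornerN, hornerM, hornerX, hornerC); ring.
Qed.

(** Going down in steps of 2 from a high order of this parity meets no exponent: [j1] is too small
    and [j1 + 2 * k + 1] has the other parity. *)
Lemma order_top : pspan_order (eigpoly A B D S) (j1 + 2 * k).
Proof.
have [n] := pspan_order_progression EF (j1 + 2 * k) (isT : 0 < 2)%N.
elim: n => [|i IH]; first by rewrite addn0.
case=> f0 [f00 Ef]; have [|_ [g [Eg eg]]] := order_step eA eB' (erefl ('X^2 * D)) eS S00 isT Ef f00.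
  by apply/eqP/eqP; rewrite -/chi indicial_eq0; lia.
apply: IH; exists g; split.
  have := eqlow0 A0 B0 D (j1 + 2 * k + 2 * i.+1) f0; rewrite eg hornerM => /eqP.
  apply: contraTneq => ->; rewrite mulr0 eq_sym mulf_neq0 //.
  by rewrite -/chi indicial_eq0; lia.
by move: Eg; rewrite (_ : _ - _ = j1 + 2 * k + 2 * i)%N //; lia.
Qed.

Let kap : C := (j1 + k)%:R.
(** This is [S0.[0] ^+ 2] times the derivative of [P / S0] at 0. For [A0], [B0], [D] it encodes the
    derivative of p, the constant term of q and the simple pole coefficient of r. *)
Let cf (P : {poly C}) := S0.[0] * P^`().[0] - S0^`().[0] * P.[0].

(* [chain_a], [chain_b] solve the two-term recursion for the ratio of the first two coefficients by an
   expression linear in the order; [chain_defect] measures the failure of the remaining equation. *)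
Let c2 := cf A0 / S0.[0].
Let c1 := cf B0 / S0.[0].
Let c0 := cf D / S0.[0].
Let chain_a := - c2 / (4 * A0.[0]).
Let chain_b := (chain_a * (3 * (2 * kap + 1) - 1) * A0.[0] - c1 + c2) / (2 * A0.[0]).
Let chain_defect := c0 - (c2 * (kap - kap ^+ 2 - (k * k.+1)%:R / 2) - kap * c1).

(** The cubic terms in [x] cancel, [chain_a] removes the quadratic term and [chain_b] the linear
    one. The remainder is the same at every order of the chain. *)
Let chain_rel x : chi (x + 1) * (chain_a * x + chain_b) + (eqlow_coef1 x - S0^`().[0] / S0.[0] * chi x)
   - (chain_a * (x - 2) + chain_b) * chi x = chain_defect.
Proof.
rewrite /chain_b /chain_a /chain_defect /c0 /c1 /c2 /cf !indicial_factor /eqlow_coef1 /kap b0E d0E.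
field.
by rewrite A00 S00.
Qed.

(** Up to the factor [chi], [rho] counts the multiples of [chain_defect] by which the ratio of the
    first two coefficients deviates from the linear expression. *)
Let chain_ok l (rho : C) := exists f0 : {poly C},
  [/\ pspan (eigpoly A B D S) ('X^(j1 + 2 * l) * f0), f0.[0] != 0 &
     chi ((j1 + 2 * l)%:R + 1) * (f0^`().[0] - (chain_a * (j1 + 2 * l)%:R + chain_b) * f0.[0])
     = chain_defect * rho * f0.[0]].

(* All the terms added to [rho] are nonnegative, so that they cannot cancel. *)
Lemma chain_exists i l : (l + i = k)%N -> exists rho, 0 <= rho /\ chain_ok l rho.
Proof.
elim: i l => [|i IH] l; first rewrite addn0.
  (* At the top order [chi] vanishes at the next integer, so the equation holds with [rho = 0]
     whatever the first two coefficients are. *)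
  move=> ->; have [f0 [f00 Ef]] := order_top; exists 0; split=> //; exists f0; split=> //.
  rewrite mulr0 mul0r (_ : chi _ = 0) ?mul0r // indicial_factor.
  rewrite (_ : _ - (j1 + 2 * k + 1)%:R = 0) ?mulr0 //; ring.
move=> eli; have [|rho [rho0 [f0 [Ef f00 ef]]]] := IH l.+1; first by lia.
set j := (j1 + 2 * l.+1)%N in Ef ef.
have cj0 : chi j%:R != 0 by rewrite indicial_eq0 /j; lia.
have [_ [g [Eg eg]]] := order_step eA eB' (erefl ('X^2 * D)) eS S00 isT Ef f00 cj0.
have g0 : S0.[0] * g.[0] = chi j%:R * f0.[0] by rewrite -hornerM -eg eqlow0.
have g00 : g.[0] != 0.
  by apply: contra_eq_neq g0 => ->; rewrite mulr0 eq_sym mulf_neq0.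
have g1 : S0^`().[0] * g.[0] + S0.[0] * g^`().[0] =
    chi (j%:R + 1) * f0^`().[0] + eqlow_coef1 j%:R * f0.[0].
  by rewrite -eqlow1 eg derivM hornerD !hornerM.
(* The factor after [1 + rho] is [chi (j - 1) / chi j]. Both arguments lie strictly between the two
   exponents, hence the quotient is positive. *)
exists ((1 + rho) * ((2 * l + 1) * (2 * i + 2))%:R / ((2 * l + 2) * (2 * i + 1))%:R).
split; first by rewrite divr_ge0 ?mulr_ge0 ?addr_ge0.
exists g; split=> //.
  by move: Eg; rewrite (_ : _ - _ = j1 + 2 * l)%N // /j; lia.
have rel := chain_rel j%:R.
have jE : (j1 + 2 * l)%:R = j%:R - 2 :> C by rewrite /j; ring.
have d1 : S0.[0] * (g^`().[0] - (chain_a * (j1 + 2 * l)%:R + chain_b) * g.[0]) =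
    chain_defect * (1 + rho) * f0.[0].
  have -> : chain_defect * (1 + rho) * f0.[0] = chain_defect * f0.[0] + chain_defect * rho * f0.[0].
    by ring.
  rewrite -ef -rel jE.
  have -> : S0.[0] * (g^`().[0] - (chain_a * (j%:R - 2) + chain_b) * g.[0]) =
     (S0^`().[0] * g.[0] + S0.[0] * g^`().[0]) - S0^`().[0] / S0.[0] * (S0.[0] * g.[0])
      - (chain_a * (j%:R - 2) + chain_b) * (S0.[0] * g.[0]) by field.
  rewrite g1 g0; ring.
have nz : ((2 * l + 2) * (2 * i + 1))%:R != 0 :> C by rewrite pnatr_eq0 muln_eq0; lia.
have ratio : chi ((j1 + 2 * l)%:R + 1) =
    ((2 * l + 1) * (2 * i + 2))%:R / ((2 * l + 2) * (2 * i + 1))%:R * chi j%:R.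
  rewrite !indicial_factor /j -eli; field.
  have nat0 (n : nat) (x : C) : x = n.+1%:R -> x != 0 by move=> ->; rewrite pnatr_eq0.
  by rewrite (nat0 (2 * i)%N) ?(nat0 (2 * l + 1)%N) //; ring.
apply: (mulfI S00).
transitivity (chi ((j1 + 2 * l)%:R + 1) * (chain_defect * (1 + rho) * f0.[0])).
  by rewrite -d1; ring.
transitivity (chain_defect * ((1 + rho) * ((2 * l + 1) * (2 * i + 2))%:R / ((2 * l + 2) * (2 * i + 1))%:R)
   * (S0.[0] * g.[0])); last by ring.
by rewrite g0 ratio; ring.
Qed.

(** At the lowest order [j1] the leading term of the image vanishes, and the next one is
    [chain_defect * (1 + rho)] times a nonzero number. A nonzero defect would give the image an
    order below every exponent. *)
Lemma chain_defect0 : chain_defect = 0.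
Proof.
apply/eqP/contraT => nz.
have [rho [rho0 [f0 [Ef f00 ef]]]] := chain_exists (add0n k).
rewrite muln0 addn0 in Ef ef.
have c0E : chi j1%:R = 0 by apply/eqP; rewrite indicial_eq0 eqxx.
have rel := chain_rel j1%:R; rewrite c0E !mulr0 !subr0 in rel.
have l1 : (eqlow A0 B0 D j1 f0)^`().[0] = chain_defect * (1 + rho) * f0.[0].
  rewrite eqlow1.
  have -> : chain_defect * (1 + rho) * f0.[0] = chain_defect * f0.[0] + chain_defect * rho * f0.[0].
    by ring.
  by rewrite -ef -rel; ring.
have l0 : (eqlow A0 B0 D j1 f0).[0] = 0 by rewrite eqlow0 -/chi c0E mul0r.
have [P eP] := horner0_mulX l0.
have P0 : P.[0] != 0.
  have -> : P.[0] = (eqlow A0 B0 D j1 f0)^`().[0].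
    by rewrite eP derivM derivX hornerD !hornerM hornerC hornerX; ring.
  by rewrite l1 !mulf_neq0 // gt_eqF // ltr_wpDr.
have eqn : 'X^2 * eqop A B D ('X^j1 * f0) = 'X^(j1 + 3) * P.
  by rewrite (eqop_low eA eB' (erefl ('X^2 * D))) eP mulrA -exprSr -addnS.
have [le [g [Eg eg]]] := span_image eS S00 Ef eqn P0.
(* [le] rules out truncation, so this order is [j1 - 1]. *)
have Ig : pspan_order (eigpoly A B D S) (j1 + 3 - (2 + 2)).
  exists g; split=> //; apply: contraNneq P0 => g0; by rewrite eg hornerM g0 mulr0.
have [j' [lej _ /eqP rj _]] := order_exponent eA eB' (erefl ('X^2 * D)) eS S00 isT Ig.
by move: rj; rewrite -/chi indicial_eq0; lia.
Qed.

Lemma second_order_relation :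
  cf D = cf A0 * (kap - kap ^+ 2 - (k * k.+1)%:R / 2) - kap * cf B0.
Proof.
have /eqP := chain_defect0; rewrite /chain_defect subr_eq0 => /eqP e.
have -> : cf D = S0.[0] * c0 by rewrite /c0; field.
rewrite e /c1 /c2; field; exact: S00.
Qed.
End OrdinaryPoint.
End LocalAnalysis.

(** * Products of linear factors and complexification *)

Section RootProducts.
Variable K : fieldType.
Implicit Types (rs : seq K) (m : K -> nat) (G S : {poly K}).

Definition rootprod rs m : {poly K} := \prod_(z <- rs) ('X - z%:P) ^+ m z.

Lemma rootprod_cons z rs m : rootprod (z :: rs) m = ('X - z%:P) ^+ m z * rootprod rs m.
Proof. by rewrite /rootprod big_cons. Qed.

Lemma rootprod_nil m : rootprod [::] m = 1.
Proof. by rewrite /rootprod big_nil. Qed.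

Lemma rootprod_neq0 rs m : rootprod rs m != 0.
Proof. by rewrite /rootprod monic_neq0 // monic_prod // => z _; rewrite monic_exp ?monicXsubC. Qed.

Lemma horner_rootprod_neq0 rs m z : z \notin rs -> (rootprod rs m).[z] != 0.
Proof.
elim: rs => [|y rs IH]; first by rewrite rootprod_nil hornerC oner_eq0.
rewrite inE negb_or rootprod_cons hornerM horner_exp hornerXsubC => /andP[zy /IH nz].
by rewrite mulf_neq0 ?expf_neq0 ?subr_eq0.
Qed.

Lemma root_rootprod1 rs z : z \in rs -> (rootprod rs (fun=> 1%N)).[z] = 0.
Proof.
elim: rs => // y rs IH; rewrite inE rootprod_cons hornerM hornerXsubC.
by case/orP => [/eqP ->|/IH ->]; rewrite ?mulr0 ?subrr ?mul0r.
Qed.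

Lemma deriv_rootprod1_neq0 rs z : uniq rs -> z \in rs -> (rootprod rs (fun=> 1%N))^`().[z] != 0.
Proof.
elim: rs => //= y rs IH /andP[yrs urs]; rewrite inE rootprod_cons derivM derivXsubC mul1r.
rewrite hornerD hornerM hornerXsubC; have [->|zy /= zrs] := eqVneq z y.
  by rewrite subrr mul0r addr0 => _; apply: horner_rootprod_neq0.
by rewrite root_rootprod1 // add0r mulf_neq0 ?subr_eq0 ?IH.
Qed.

Lemma rootprod_dvd rs m G : uniq rs -> (forall z, z \in rs -> ('X - z%:P) ^+ m z %| G) ->
  rootprod rs m %| G.
Proof.
elim: rs => [|y rs IH] /=; first by rewrite rootprod_nil dvd1p.
move=> /andP[yrs urs] dv; rewrite rootprod_cons Gauss_dvdp.
  by rewrite dv ?mem_head // IH // => z zrs; apply: dv; rewrite inE zrs orbT.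
by rewrite coprimep_expl // coprimep_sym coprimep_XsubC horner_rootprod_neq0.
Qed.

(** The logarithmic derivative has only simple poles, with residue [m z] at [z]; its numerator over
    the squarefree product therefore takes the value [m z] times the derivative of that product. *)
Lemma rootprod_logderiv rs m : uniq rs -> exists t,
  (rootprod rs m)^`() * rootprod rs (fun=> 1%N) = rootprod rs m * t /\
  forall z, z \in rs -> t.[z] = (m z)%:R * (rootprod rs (fun=> 1%N))^`().[z].
Proof.
elim: rs => [_|y rs IH /=]; first by exists 0; rewrite !rootprod_nil derivC mul0r mulr0.
move=> /andP[yrs /IH[t [et tz]]].
exists ((m y)%:R * rootprod rs (fun=> 1%N) + ('X - y%:P) * t); split.
  rewrite !rootprod_cons expr1; move: et; set P := rootprod rs m; set H := rootprod rs _ => et.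
  have -> : ('X - y%:P) ^+ m y * P * ((m y)%:R * H + ('X - y%:P) * t) =
    (m y)%:R * ('X - y%:P) ^+ m y * P * H + ('X - y%:P) ^+ (m y).+1 * (P * t).
    by rewrite exprS; ring.
  rewrite -et derivM deriv_exp derivXsubC mul1r exprS; case: (m y) => [|n]; first by rewrite mulr0n; ring.
  by rewrite -mulr_natl /= exprS; ring.
move=> z; rewrite inE rootprod_cons derivM derivXsubC mul1r -polyC_natr.
rewrite !(hornerXsubC, hornerD, hornerM, hornerC).
have [->|zy /= zrs] := eqVneq z y; first by rewrite subrr !mul0r !addr0.
by rewrite root_rootprod1 // mulr0 !add0r tz //; ring.
Qed.

Lemma XsubC_multiplicity G z : G != 0 ->
  exists n G0, G = ('X - z%:P) ^+ n * G0 /\ G0.[z] != 0.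
Proof.
move=> G0; have [n [g nr eg]] := multiplicity_XsubC G z.
by exists n, g; rewrite mulrC -eg; split=> //; rewrite G0 in nr.
Qed.

End RootProducts.

Lemma dvdp_of_multiplicities (K : closedFieldType) (S G : {poly K}) : S != 0 ->
  (forall z n S0, S = ('X - z%:P) ^+ n * S0 -> S0.[z] != 0 -> ('X - z%:P) ^+ n %| G) -> S %| G.
Proof.
(* The hypothesis is extended to every power dividing [S], a form that survives splitting off one
   root at a time. *)
move=> S0 dv; have {}dv z n : ('X - z%:P) ^+ n %| S -> ('X - z%:P) ^+ n %| G.
  have [k [T [eS Tz]]] := XsubC_multiplicity z S0; move/(_ z k T eS Tz): dv; rewrite eS.
  rewrite Gauss_dvdpl ?dvdp_exp2r; last by rewrite coprimep_expl // coprimep_sym coprimep_XsubC.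
  have X0 : ('X - z%:P) ^+ k != 0 by rewrite monic_neq0 ?monic_exp ?monicXsubC.
  by move=> dG dn; apply: dvdp_trans dn dG.
have [rts eS] := closed_field_poly_normal S.
rewrite eS dvdpZl ?lead_coef_eq0 //.
have {}dv z n : ('X - z%:P) ^+ n %| \prod_(z <- rts) ('X - z%:P) -> ('X - z%:P) ^+ n %| G.
  by move=> d; apply: dv; rewrite eS dvdpZr ?lead_coef_eq0.
elim: rts G dv {eS} => [|y rts IH] G dv; first by rewrite big_nil dvd1p.
have Xy : 'X - y%:P != 0 by rewrite polyXsubC_eq0.
have /dvdpP[G1 eG] : 'X - y%:P %| G.
  by rewrite -[_ - _]expr1; apply: dv; rewrite big_cons expr1 dvdp_mulr.
rewrite big_cons eG mulrC dvdp_mul2r //; apply: IH => z n dz.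
have [ezy|zy] := eqVneq z y.
  rewrite ezy in dz *; rewrite -(dvdp_mul2r _ _ Xy) -eG -exprSr; apply: dv.
  by rewrite big_cons exprS dvdp_mul2l.
have : ('X - z%:P) ^+ n %| G by apply: dv; rewrite big_cons dvdp_mull.
by rewrite eG Gauss_dvdpl // coprimep_expl // coprimep_XsubC rootE hornerXsubC subr_eq0 eq_sym.
Qed.

(** * Real polynomials at complex points *)

Section Complexification.
Variable R : rcfType.
Notation K := (complex R).
Implicit Types (P Q : {poly R}) (z : K).

Definition cpoly P : {poly K} := map_poly (real_complex R) P.

Definition conj_invariant (T : Type) (f : K -> T) := forall z, f (conjc z) = f z.

(** Conjugation permutes the factors, so the coefficients of the product are their own
    conjugates. *)
Lemma real_rootprod (rs : seq K) (m : K -> nat) : uniq rs ->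
  (forall z, z \in rs -> conjc z \in rs) -> conj_invariant m ->
  exists P, cpoly P = rootprod rs m.
Proof.
move=> urs crs cm; set G := rootprod rs m.
have crs2 : perm_eq (map conjc rs) rs.
  apply: uniq_perm => // [|z]; first by rewrite map_inj_uniq //; apply: inv_inj; apply: conjcK.
  apply/mapP/idP => [[y yrs ->]|zrs]; first exact: crs.
  by exists (conjc z); rewrite ?conjcK ?crs.
have cG : map_poly conjc G = G.
  rewrite /G /rootprod rmorph_prod -[RHS](perm_big _ crs2) big_map.
  by apply: eq_bigr => z _; rewrite rmorphXn /= rmorphB /= map_polyX map_polyC /= cm.
exists (map_poly (@complex.Re R) G); apply/polyP => i; rewrite coef_map /= coef_map_id0 //.
have := congr1 (fun p : {poly K} => p`_i) cG; rewrite coef_map /=.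
case: (G`_i) => a b [] eb; congr (_ +i* _)%C.
by lra.
Qed.

Lemma cpolyM P Q : cpoly (P * Q) = cpoly P * cpoly Q. Proof. exact: rmorphM. Qed.
Lemma cpolyD P Q : cpoly (P + Q) = cpoly P + cpoly Q. Proof. exact: rmorphD. Qed.
Lemma cpolyN P : cpoly (- P) = - cpoly P. Proof. exact: rmorphN. Qed.
Lemma cpolyC c : cpoly c%:P = (real_complex R c)%:P. Proof. exact: map_polyC. Qed.
Lemma cpolyX : cpoly 'X = 'X. Proof. exact: map_polyX. Qed.
Lemma cpolyE n P : cpoly (P ^+ n) = cpoly P ^+ n. Proof. exact: rmorphXn. Qed.
Lemma deriv_cpoly P : (cpoly P)^`() = cpoly P^`(). Proof. exact: deriv_map. Qed.

Lemma conj_horner_cpoly P z : (cpoly P).[conjc z] = conjc (cpoly P).[z].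
Proof.
rewrite -horner_map /= /cpoly -map_poly_comp; congr (_.[_]).
by apply: eq_map_poly => x /=; rewrite oppr0.
Qed.

Lemma horner_cpoly P (x : R) : (cpoly P).[x%:C%C] = (P.[x])%:C%C.
Proof. by rewrite /cpoly horner_map. Qed.

(** One finite list contains a candidate for every [z]; taking the first candidate that fits depends
    only on the predicate, which is the same for conjugate points. *)
Lemma conj_choice (pr : K -> nat * nat -> bool) (rs : seq K) : (forall z, z \in rs -> exists x, pr z x) ->
  (forall z, pr (conjc z) =1 pr z) ->
  exists f : K -> nat * nat, (forall z, z \in rs -> pr z (f z)) /\ conj_invariant f.
Proof.
move=> ex cpr; have [L hL] : exists L, forall z, z \in rs -> has (pr z) L.
  elim: rs ex => [|y rs IH] ex; first by exists [::].
  have [|L hL] := IH; first by move=> z zrs; apply: ex; rewrite inE zrs orbT.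
  have [x px] := ex y (mem_head _ _); exists (x :: L) => z; rewrite inE /=.
  by case/orP => [/eqP ->|/hL ->]; rewrite ?px ?orbT.
exists (fun z => nth (0%N, 0%N) L (find (pr z) L)); split=> [z /hL|z]; first exact: nth_find.
by rewrite (eq_find (cpr z)).
Qed.

Definition localize z P : {poly K} := cpoly P \Po ('X + z%:P).

Lemma localizeM z P Q : localize z (P * Q) = localize z P * localize z Q.
Proof. by rewrite /localize cpolyM comp_polyM. Qed.
Lemma localizeD z P Q : localize z (P + Q) = localize z P + localize z Q.
Proof. by rewrite /localize cpolyD comp_polyD. Qed.
Lemma localizeE n z P : localize z (P ^+ n) = localize z P ^+ n.
Proof. by rewrite /localize cpolyE rmorphXn. Qed.
Lemma localizeZ z c P : localize z (c *: P) = (c%:C)%C *: localize z P.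
Proof. by rewrite /localize /cpoly map_polyZ comp_polyZ. Qed.

Lemma deriv_localize z P : (localize z P)^`() = localize z P^`().
Proof. by rewrite /localize deriv_comp derivD derivX derivC addr0 mulr1 deriv_cpoly. Qed.

Lemma localize0 z P : (localize z P).[0] = (cpoly P).[z].
Proof. by rewrite /localize horner_comp hornerD hornerX hornerC add0r. Qed.

Lemma size_localize z P : size (localize z P) = size P.
Proof.
rewrite /localize size_comp_poly2 ?size_XaddC //; exact: size_map_poly.
Qed.

Lemma localize_dvd n z P : ('X^n %| localize z P) = (('X - z%:P) ^+ n %| cpoly P).
Proof.
have e : ('X - z%:P) ^+ n \Po ('X + z%:P) = 'X^n.
  by rewrite rmorphXn /= comp_polyB comp_polyX comp_polyC addrK.
have e2 (p : {poly K}) : p \Po ('X + z%:P) \Po ('X - z%:P) = p.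
  by rewrite -comp_polyA comp_polyD comp_polyX comp_polyC subrK comp_polyXr.
apply/idP/idP => /dvdpP[q eq]; apply/dvdpP.
  exists (q \Po ('X - z%:P)); rewrite -[LHS]e2 -/(localize z P) eq comp_polyM.
  by rewrite -e e2.
by exists (q \Po ('X + z%:P)); rewrite /localize eq comp_polyM e.
Qed.

Lemma exceptional_localize (A B D S : {poly R}) (F : seq nat) z :
  (forall n, n \notin F -> exists (P : {poly R}) lam, size P = n.+1 /\
     A * P^`()^`() + B * P^`() + D * P = lam *: (S * P)) ->
  forall n, n \notin F -> exists f : {poly K}, size f = n.+1 /\
    eigpoly (localize z A) (localize z B) (localize z D) (localize z S) f.
Proof.
move=> ex n /ex[P [lam [sP eP]]]; exists (localize z P); rewrite size_localize; split=> //.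
exists (lam%:C)%C; rewrite /eqop !deriv_localize -!localizeM -!localizeD eP.
by rewrite localizeZ.
Qed.

End Complexification.

(** * Degree bounds at infinity *)

Lemma coef_top_mul (R : nzRingType) (p q : {poly R}) a b :
  (size p <= a.+1)%N -> (size q <= b.+1)%N -> (p * q)`_(a + b) = p`_a * q`_b.
Proof.
move=> sp sq; rewrite coefM (bigD1 (inord a)) //= inordK ?ltnS ?leq_addr // addKn.
rewrite big1 ?addr0 // => i ne; have [lt|lt|eq] := ltngtP i a.
- by rewrite [q`__]nth_default ?mulr0 //; apply: leq_trans sq _; lia.
- by rewrite [p`__]nth_default ?mul0r //; apply: leq_trans sp _; lia.
by case/eqP: ne; apply/val_inj; rewrite /= inordK ?ltnS ?leq_addr.
Qed.

(** If [B] or [D] were too large, the top coefficient of the equation for an eigenpolynomial of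
    degree [n + 1] would read [(n + 1) b + d = 0]. Two consecutive [n] force [b = d = 0], and the
    bound descends. *)
Lemma size_coef_bound (R : numFieldType) (A B D S : {poly R}) (F : seq nat) M0 :
  (forall n, n \notin F -> exists (P : {poly R}) lam, size P = n.+1 /\
     A * P^`()^`() + B * P^`() + D * P = lam *: (S * P)) ->
  (size A <= M0 + 3)%N -> (size S <= M0 + 1)%N -> (size B <= M0 + 2)%N && (size D <= M0 + 1)%N.
Proof.
move=> ex sA sS.
suff H k M : M = (M0 + k)%N -> (size B <= M + 2)%N && (size D <= M + 1)%N ->
    (size B <= M0 + 2)%N && (size D <= M0 + 1)%N.
  by apply: (H (size B + size D)%N _ erefl); apply/andP; split; lia.
elim: k M => [|k IH] M eM; first by rewrite eM addn0.
case/andP => sB sD; apply: (IH _ erefl).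
have top n : n.+1 \notin F -> n.+1%:R * B`_M.+1 + D`_M = 0.
  move=> /ex[P [lam [sP eP]]].
  have c0 : P`_n.+1 != 0 by rewrite -[n.+1]/(n.+2.-1) -sP -lead_coefE lead_coef_eq0 -size_poly_gt0 sP.
  have := congr1 (fun p : {poly R} => p`_(M + n.+1)) eP.
  have s1 : (size P^`() <= n.+1)%N.
    by rewrite -ltnS -sP; apply: lt_size_deriv; rewrite -size_poly_gt0 sP.
  have s2 : (size P^`()^`() <= n)%N.
    have [->|nz] := eqVneq P^`() 0; first by rewrite deriv0 size_poly0.
    by rewrite -ltnS; apply: leq_trans (lt_size_deriv nz) s1.
  rewrite !coefD coefZ.
  rewrite [(A * _)`__]nth_default; last first.
    by apply: leq_trans (size_polyMleq _ _) _; lia.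
  rewrite [(S * _)`__]nth_default; last first.
    by apply: leq_trans (size_polyMleq _ _) _; rewrite sP; lia.
  have -> : (B * P^`())`_(M + n.+1) = B`_M.+1 * P^`()`_n.
    by rewrite addnS -addSn coef_top_mul // -addn2.
  have -> : (D * P)`_(M + n.+1) = D`_M * P`_n.+1 by rewrite coef_top_mul ?sP // -addn1.
  rewrite coef_deriv add0r mulr0 -mulr_natl => e.
  by apply: (mulIf c0); rewrite mul0r -[RHS]e; ring.
pose n1 := (\max_(i <- F) i)%N.
have nF n : (n1 <= n)%N -> n.+1 \notin F.
  move=> le; apply/negP => inF.
  by have := @leq_bigmax_seq _ F xpredT id _ inF isT; rewrite -/n1 ltnNge le.
have t1 := top _ (nF _ (leqnn n1)); have t2 := top _ (nF _ (leqnSn n1)).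
have B0 : B`_M.+1 = 0.
  transitivity (n1.+2%:R * B`_M.+1 + D`_M - (n1.+1%:R * B`_M.+1 + D`_M)); last by rewrite t1 t2 subrr.
  by rewrite -[n1.+2]addn1 natrD; ring.
have D0 : D`_M = 0 by move: t1; rewrite B0 mulr0 add0r.
apply/andP; split; apply/leq_sizeP => j.
  rewrite leq_eqVlt => /orP[/eqP <-|lt]; first by rewrite -[RHS]B0; congr (_`_ _); lia.
  by rewrite nth_default //; apply: leq_trans sB _; lia.
rewrite leq_eqVlt => /orP[/eqP <-|lt]; first by rewrite -[RHS]D0; congr (_`_ _); lia.
by rewrite nth_default //; apply: leq_trans sD _; lia.
Qed.

(** * The polynomial form of the problem *)

(** Ensures that the exponent of [tau] plus the forced order [j] of an eigenpolynomial covers the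
    exponent [j + k] of the denominator [kp]. *)
Lemma leq_triangular k : (k <= (k * k.+1)./2)%N.
Proof.
by case: k => // k; rewrite -leq_double even_halfK ?oddM /= ?andbN ?orbF //; nia.
Qed.

Section JacobiPolynomials.
Variable R : rcfType.
Notation K := (complex R).
Implicit Types (z : K).

Definition jp : {poly R} := 'X^2 - 1.

Definition poly_exceptional (A B D S : {poly R}) (F : seq nat) :=
  forall n, n \notin F -> exists (P : {poly R}) lam, size P = n.+1 /\
     A * P^`()^`() + B * P^`() + D * P = lam *: (S * P).

Lemma cpoly_jp : cpoly jp = ('X - 1%:P) * ('X - (-1)%:P).
Proof. by rewrite /jp cpolyD cpolyE cpolyX cpolyN -polyC1 cpolyC rmorph1 polyCN polyC1; ring. Qed.

Lemma cpoly_jp_eq0 z : ((cpoly jp).[z] == 0) = (z == 1) || (z == -1).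
Proof. by rewrite cpoly_jp hornerM !hornerXsubC mulf_eq0 !subr_eq0. Qed.

Lemma deriv_jp : jp^`() = 'X + 'X.
Proof. by rewrite /jp derivB derivXn -polyC1 derivC subr0 mulr2n. Qed.

Lemma horner_deriv_jp z : (cpoly jp^`()).[z] = z + z.
Proof. by rewrite deriv_jp cpolyD cpolyX hornerD hornerX. Qed.

Lemma size_jp : size jp = 3.
Proof. by rewrite /jp -polyC1 size_XnsubC. Qed.

Lemma jp_neq0 : jp != 0. Proof. by rewrite -size_poly_gt0 size_jp. Qed.

Lemma localize_root z (P : {poly R}) : (cpoly P).[z] = 0 -> exists h,
  [/\ localize z P = 'X * h, h.[0] = (cpoly P^`()).[z] & 2 * h^`().[0] = (cpoly P^`()^`()).[z]].
Proof.
rewrite -localize0 => /horner0_mulX[h eh]; exists h; split=> //.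
  by rewrite -localize0 -deriv_localize eh derivM derivX !hornerE.
rewrite -localize0 -!deriv_localize eh derivM derivX mul1r derivD derivM derivX mul1r.
rewrite !(hornerD, hornerM, hornerX, hornerC); ring.
Qed.

Lemma cpoly_dvd (P Q : {poly R}) : (cpoly P %| cpoly Q) = (P %| Q).
Proof. exact: dvdp_map. Qed.

Lemma cpoly_eq0 (P : {poly R}) : (cpoly P == 0) = (P == 0).
Proof. exact: map_poly_eq0. Qed.

Lemma dvd_XsubC2 (P : {poly R}) z :
  (cpoly P).[z] = 0 -> (cpoly P^`()).[z] = 0 -> ('X - z%:P) ^+ 2 %| cpoly P.
Proof.
move=> Pz dPz; have [h [eh h0 _]] := localize_root Pz.
rewrite dPz in h0; have [g eg] := horner0_mulX h0.
by rewrite -localize_dvd eh eg mulrA -expr2 dvdp_mulr.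
Qed.

(* For the operator with coefficients [p], [Q / H], [V / (H^2 p)], gauged with logarithmic derivative
   [t / H + w / (H p)], this is the numerator over [H^2 p] of the zeroth order coefficient minus that of
   [Tng] for a [tau] with logarithmic derivative [t / H]. *)
Definition defect (p H Q V w t : {poly R}) :=
  V + w * w - Q * w - p * (w^`() * H - w * H^`()) + p^`() * w * H
  - (p * p * (t^`() * H - t * H^`()) + p * p * (t^`() * H - t * H^`())) - p * p^`() * t * H.

(** The value at [z] vanishes by the indicial data, the derivative by the last hypothesis, which is
    the second order relation at [z]. *)
Lemma defect_double_root p H Q V w t z (ev := fun P => (cpoly P).[z]) (kap : nat) (m : K) :
  ev H = 0 -> ev Q = - (2 * kap%:R) * ev H^`() * ev p -> ev w = - kap%:R * ev H^`() * ev p ->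
  ev t = m * ev H^`() -> ev V = (kap%:R ^+ 2 + kap%:R - 2 * m) * (ev H^`() * ev p) ^+ 2 ->
  ev V^`() + kap%:R * ev H^`() * ev p * ev Q^`() - 2 * kap%:R * ev p^`() * ev H^`() ^+ 2 * ev p
  - kap%:R * ev p ^+ 2 * ev H^`() * ev H^`()^`() + 3 * ev p * ev p^`() * m * ev H^`() ^+ 2
  + 2 * ev p ^+ 2 * m * ev H^`() * ev H^`()^`() = 0 ->
  ('X - z%:P) ^+ 2 %| cpoly (defect p H Q V w t).
Proof.
move=> eH eQ ew et eV so; apply: dvd_XsubC2; rewrite /defect.
  rewrite !(cpolyD, cpolyN, cpolyM) !(hornerD, hornerN, hornerM) -!/(ev _).
  by rewrite eH eQ ew et eV; ring.
rewrite -[RHS]so !(derivD, derivN, derivM) !(cpolyD, cpolyN, cpolyM) !(hornerD, hornerN, hornerM) -!/(ev _).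
by rewrite eH eQ ew et; ring.
Qed.

(** Where [p] vanishes, the value of [defect] is the indicial polynomial evaluated at [a]. *)
Lemma defect_simple_root p H Q V w t z (ev := fun P => (cpoly P).[z]) (a : K) :
  ev p = 0 -> ev w = - (a * ev p^`() * ev H) ->
  (ev p^`() * ev H) ^+ 2 * (a * (a - 1)) + ev Q * ev H * ev p^`() * a + ev V = 0 ->
  ('X - z%:P) %| cpoly (defect p H Q V w t).
Proof.
move=> pz ew e; rewrite dvdp_XsubCl rootE /defect -e.
rewrite !(cpolyD, cpolyN, cpolyM) !(hornerD, hornerN, hornerM) -!/(ev _) pz ew.
by apply/eqP; ring.
Qed.

Lemma size_mul_leq_add (P Q : {poly R}) m n N : (size P <= m.+1)%N -> (size Q <= n)%N ->
  (m + n <= N)%N -> (size (P * Q)%R <= N)%N.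
Proof.
move=> hP hQ hN; have [->|Q0] := eqVneq Q 0; first by rewrite mulr0 size_poly0.
by apply: leq_trans (size_polyMleq _ _) _; move: hP hQ hN; lia.
Qed.

Lemma size_deriv_leq (P : {poly R}) n : (size P <= n.+1)%N -> (size P^`() <= n)%N.
Proof.
move=> hP; have [->|P0] := eqVneq P 0; first by rewrite deriv0 size_poly0.
by rewrite -ltnS; apply: leq_trans (lt_size_deriv P0) hP.
Qed.

(** For [p] of size 3 the bound is the size of [H ^+ 2 * p], so the quotient of the two is bounded
    at infinity. *)
Lemma size_defect (p H Q V w t : {poly R}) s : (size p <= 3)%N -> size H = s.+1 -> (size Q <= s.+2)%N ->
  (size V <= 2 * s.+1 + 1)%N -> (size w <= s.+2)%N -> (size t <= s)%N ->
  (size (defect p H Q V w t) <= 2 * s.+1 + 1)%N.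
Proof.
move=> sp es sQ sV sw st; have szM := size_mul_leq_add.
have szD (P P' : {poly R}) n : (size P <= n)%N -> (size P' <= n)%N -> (size (P + P')%R <= n)%N.
  by move=> h1 h2; apply: leq_trans (size_polyD _ _) _; rewrite geq_max h1.
have sdH := size_deriv_leq (eq_leq es); have sdw := size_deriv_leq sw.
have sdp := size_deriv_leq sp.
have sp2 : (size (p * p)%R <= 5)%N by apply: (szM _ _ 2 3).
have sN (P : {poly R}) n : (size P <= n)%N -> (size (- P)%R <= n)%N by rewrite size_polyN.
have sD : (size (p * p * (t^`() * H - t * H^`()))%R <= 2 * s.+1 + 1)%N.
  have [->|t0] := eqVneq t 0; first by rewrite deriv0 !mul0r subrr mulr0 size_poly0.
  case: s st es sdH {sw sQ sV sdw} => [|s] st es sdH; first by rewrite leqn0 size_poly_eq0 (negPf t0) in st.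
  have sdt := size_deriv_leq st.
  apply: (szM _ _ 4 (2 * s + 1)%N) => //; last by lia.
  apply: (szD); last apply: (sN); first by rewrite mulrC; apply: (szM _ _ s.+1 s); rewrite ?es //; lia.
  by apply: (szM _ _ s s.+1) => //; lia.
rewrite /defect; repeat first [apply: (szD) | apply: (sN)]; rewrite //.
- by apply: (szM _ _ s.+1 s.+2) => //; lia.
- by apply: (szM _ _ s.+1 s.+2) => //; lia.
- apply: (szM _ _ 2 (2 * s + 1)%N) => //; last by lia.
  apply: (szD); last apply: (sN); first by rewrite mulrC; apply: (szM _ _ s s.+1); rewrite ?es //; lia.
  by apply: (szM _ _ s.+1 s) => //; lia.
- rewrite mulrC; apply: (szM _ _ s (s.+3)); rewrite ?es //; last by lia.
  by apply: (szM _ _ 1 s.+2) => //; lia.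
rewrite mulrC; apply: (szM _ _ s (s + 3)%N); rewrite ?es //; last by lia.
apply: (szM _ _ 3 s) => //; last by lia.
by apply: (szM _ _ 2 2).
Qed.

(** * Pole orders of the coefficients *)

Section Reduction.
Variables (S Q V : {poly R}) (F : seq nat).
Hypothesis S0 : S != 0.
Hypothesis ex : poly_exceptional (S * jp) Q V S F.

(** Away from 1 and -1, q has at most simple and r at most double poles; at 1 and -1, q is regular
    and r has at most a simple pole. So [H] and [H ^+ 2 * jp] are denominators, with [H]
    squarefree. *)
Lemma simple_poles : exists (rs : seq K) (H Q1 V1 : {poly R}),
  [/\ [/\ uniq rs, forall z, z \in rs -> conjc z \in rs, (1 \notin rs) & (-1 \notin rs)],
      cpoly H = rootprod rs (fun=> 1%N), Q * H = S * Q1 & V * H ^+ 2 * jp = S * V1].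
Proof.
have [rts eS] := closed_field_poly_normal (cpoly S).
have rtsE z : (z \in rts) = root (cpoly S) z.
  by rewrite eS rootZ ?lead_coef_eq0 ?cpoly_eq0 // root_prod_XsubC.
pose rs := undup [seq z <- rts | (z != 1) && (z != -1)].
have rsE z : (z \in rs) = [&& z != 1, z != -1 & root (cpoly S) z].
  by rewrite mem_undup mem_filter rtsE -andbA.
have crs z : z \in rs -> conjc z \in rs.
  rewrite !rsE !rootE conj_horner_cpoly conjc_eq0 => /and3P[z1 zN1 ->]; rewrite andbT.
  by rewrite -[1]conjc1 -rmorphN !(inj_eq (inv_inj (@conjcK R))) z1.
have [H eH] := real_rootprod (undup_uniq _) crs (fun _ : K => erefl 1%N).
suff [/dvdpP[Q1 eQ] /dvdpP[V1 eV]] : S %| Q * H /\ S %| V * H ^+ 2 * jp.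
  exists rs, H, Q1, V1; split=> //; [|by rewrite eQ mulrC|by rewrite eV mulrC].
  by split; rewrite ?undup_uniq // rsE eqxx ?andbF.
suff dv z n S1 : cpoly S = ('X - z%:P) ^+ n * S1 -> S1.[z] != 0 ->
    (('X - z%:P) ^+ n %| cpoly (Q * H)) && (('X - z%:P) ^+ n %| cpoly (V * H ^+ 2 * jp)).
  rewrite -!cpoly_dvd; split; apply: dvdp_of_multiplicities; rewrite ?cpoly_eq0 // => z n S1 e1 e2;
  by have /andP[] := dv z n S1 e1 e2.
move=> eS1 S1z.
have /dvdXP[T eT] : 'X^n %| localize z S by rewrite localize_dvd eS1 dvdp_mulr.
have T0 : T.[0] != 0.
  suff -> : T = S1 \Po ('X + z%:P) by rewrite horner_comp hornerD hornerX hornerC add0r.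
  have Xn0 : 'X^n != 0 :> {poly K} by rewrite monic_neq0 ?monicXn.
  apply: (mulfI Xn0); rewrite -eT /localize eS1 comp_polyM rmorphXn /= comp_polyB comp_polyX.
  by rewrite comp_polyC addrK.
rewrite -!localize_dvd !(localizeE, localizeM).
have exz := exceptional_localize z ex; rewrite localizeM in exz.
have [n0|n0] := posnP n; first by rewrite n0 !dvd1p.
(* At 1 and -1 the factor [jp] gives the leading coefficient one order more than [S], so
   [pole_bound] applies with [d = n + 1]; elsewhere it applies with [d = n]. *)
have [pz|pz] := eqVneq (cpoly jp).[z] 0.
  have [ph [eph _ _]] := localize_root pz.
  have eA : localize z S * localize z jp = 'X^(n.+1) * (T * ph) by rewrite eT eph exprS; ring.
  have := pole_bound exz eA eT T0; rewrite addn1 leqnn => /(_ isT).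
  rewrite exprS dvdp_mul2l ?polyX_eq0 // => /andP[dB].
  rewrite expr2 -mulrA dvdp_mul2l ?polyX_eq0 // => dD; rewrite dvdp_mulr //=.
  have -> : localize z V * localize z H ^+ 2 * localize z jp =
    'X * localize z V * (localize z H ^+ 2 * ph) by rewrite eph; ring.
  by rewrite dvdp_mulr.
have zrs : z \in rs.
  move: pz; rewrite cpoly_jp_eq0 negb_or rsE => /andP[-> ->] /=.
  by rewrite rootE eS1 hornerM horner_exp hornerXsubC subrr expr0n eqn0Ngt n0 mul0r.
have [h [eh _ _]] : exists h, [/\ localize z H = 'X * h, h.[0] = (cpoly H^`()).[z] & 2 * h^`().[0] = (cpoly H^`()^`()).[z]].
  by apply: localize_root; rewrite eH root_rootprod1.
have eA : localize z S * localize z jp = 'X^n * (T * localize z jp) by rewrite eT mulrA.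
have /andP[dB dD] := pole_bound exz eA eT T0 (leq_addr _ _).
have -> : localize z Q * localize z H = 'X * localize z Q * h by rewrite eh; ring.
have -> : localize z V * localize z H ^+ 2 * localize z jp =
    'X^2 * localize z V * (h ^+ 2 * localize z jp) by rewrite eh; ring.
by rewrite (dvdp_mulr _ dB) (dvdp_mulr _ dD).
Qed.

End Reduction.

(** * The operator with coefficients [jp], [Q / H], [V / (H ^+ 2 * jp)] *)

Section Reduced.
Variables (rs : seq K) (H Q V : {poly R}) (F : seq nat).
Hypotheses (urs : uniq rs) (crs : forall z, z \in rs -> conjc z \in rs)
  (rs1 : 1 \notin rs) (rsN1 : -1 \notin rs) (eH : cpoly H = rootprod rs (fun=> 1%N)).
Hypothesis ex : poly_exceptional (H ^+ 2 * jp ^+ 2) (Q * H * jp) V (H ^+ 2 * jp) F.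

Lemma reduced_neq0 : H != 0.
Proof. by rewrite -cpoly_eq0 eH rootprod_neq0. Qed.

Let H0 := reduced_neq0.

(** At infinity q grows at most linearly and r is bounded; clearing the denominators turns this into
    the two bounds. *)
Lemma reduced_sizes : (size Q <= size H + 1)%N && (size V <= 2 * size H + 1)%N.
Proof.
have sH : (0 < size H)%N by rewrite size_poly_gt0.
have sHH : size (H ^+ 2) = (2 * size H).-1 by rewrite expr2 size_mul // addnn mul2n.
have sp2 : size (jp ^+ 2) = 5 by rewrite expr2 size_mul ?jp_neq0 // size_jp.
have nat1 n : (0 < n)%N -> ((2 * n).-1 + 5).-1 = (2 * n + 3)%N by lia.
have nat2 n : (0 < n)%N -> ((2 * n).-1 + 3).-1 = (2 * n + 1)%N by lia.
have nat3 m n : (0 < n)%N -> (0 < m)%N -> (((m + n).-1 + 3).-1 <= 2 * n + 2)%N -> (m <= n + 1)%N by lia.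
have sA : size (H ^+ 2 * jp ^+ 2) = (2 * size H + 3)%N.
  by rewrite size_mul ?expf_neq0 ?jp_neq0 // sHH sp2 nat1.
have sS : size (H ^+ 2 * jp) = (2 * size H + 1)%N.
  by rewrite size_mul ?expf_neq0 ?jp_neq0 // sHH size_jp nat2.
have := size_coef_bound (M0 := (2 * size H)%N) ex; rewrite sA sS !leqnn => /(_ isT isT).
move=> /andP[sB ->]; rewrite andbT; have [->|Q0] := eqVneq Q 0; first by rewrite size_poly0.
move: sB; rewrite !size_mul ?mulf_neq0 ?jp_neq0 // size_jp; apply: nat3 => //.
by rewrite size_poly_gt0.
Qed.

Lemma reduced_localize z : z \in rs -> exists h,
  [/\ localize z H = 'X * h, h.[0] = (cpoly H^`()).[z] & 2 * h^`().[0] = (cpoly H^`()^`()).[z]].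
Proof. by move=> zrs; apply: localize_root; rewrite eH root_rootprod1. Qed.

Lemma reduced_deriv_neq0 z : z \in rs -> (cpoly H^`()).[z] != 0.
Proof. by move=> zrs; rewrite -deriv_cpoly eH deriv_rootprod1_neq0. Qed.

Lemma reduced_jp_neq0 z : z \in rs -> (cpoly jp).[z] != 0.
Proof.
move=> zrs; rewrite cpoly_jp_eq0 negb_or; apply/andP.
by split; apply: contraTneq zrs => ->.
Qed.

(* The indicial roots at [z] are [j] and [j + 2 * k + 1]. *)
Definition is_exponent z (jk : nat * nat) :=
  ((cpoly Q).[z] == - (2 * jk.1 + 2 * jk.2)%:R * (cpoly (H^`() * jp)).[z]) &&
  ((cpoly V).[z] == (jk.1 * (jk.1 + 2 * jk.2 + 1))%:R * (cpoly ((H^`() * jp) ^+ 2)).[z]).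

Section AtRoot.
Variables (z : K) (zrs : z \in rs) (h : {poly K}).
Hypotheses (eh : localize z H = 'X * h) (h0 : h.[0] = (cpoly H^`()).[z]).

Let exz := exceptional_localize z ex.
Let A0 := h ^+ 2 * localize z jp ^+ 2.
Let B0 := localize z Q * h * localize z jp.
Let S0 := h ^+ 2 * localize z jp.
Let eA : localize z (H ^+ 2 * jp ^+ 2) = 'X^2 * A0.
Proof. by rewrite localizeM !localizeE eh /A0; ring. Qed.
Let eB : localize z (Q * H * jp) = 'X * B0.
Proof. by rewrite !localizeM eh /B0; ring. Qed.
Let eS : localize z (H ^+ 2 * jp) = 'X^2 * S0.
Proof. by rewrite localizeM !localizeE eh /S0; ring. Qed.
Let h00 : h.[0] != 0. Proof. by rewrite h0 reduced_deriv_neq0. Qed.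
Let p00 : (localize z jp).[0] != 0. Proof. by rewrite localize0 reduced_jp_neq0. Qed.
Let A00 : A0.[0] != 0.
Proof. by rewrite /A0 hornerM !horner_exp mulf_neq0 ?expf_neq0. Qed.
Let S00 : S0.[0] != 0.
Proof. by rewrite /S0 hornerM !horner_exp mulf_neq0 ?expf_neq0. Qed.

Lemma exists_is_exponent : exists jk, is_exponent z jk.
Proof.
have [j [k [eb ed]]] := exists_exponents exz eA eB eS A00 S00.
exists (j, k); rewrite /is_exponent /= -!localize0 localizeE !localizeM.
rewrite -deriv_localize eh derivM derivX mul1r; apply/andP; split; apply/eqP.
  have hp : h.[0] * (localize z jp).[0] != 0 by rewrite mulf_neq0.
  apply: (mulIf hp); move: eb; rewrite /A0 /B0 !(hornerD, hornerM, horner_exp, hornerX).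
  move=> e; rewrite mulrA e; ring.
by rewrite ed /A0 !(hornerD, hornerM, horner_exp, hornerX); ring.
Qed.

Variables j k : nat.
Hypothesis ejk : is_exponent z (j, k).

Let b0E : B0.[0] = - (2 * j + 2 * k)%:R * A0.[0].
Proof.
case/andP: ejk => /eqP + _; rewrite /= /A0 /B0 cpolyM !(hornerM, horner_exp) -h0 -!localize0 => ->.
ring.
Qed.
Let d0E : (localize z V).[0] = (j * (j + 2 * k + 1))%:R * A0.[0].
Proof.
case/andP: ejk => _ /eqP; rewrite /= /A0 cpolyE cpolyM !(hornerM, horner_exp) -h0 -!localize0 => ->.
ring.
Qed.

Lemma dvd_at_root P lam : H ^+ 2 * jp ^+ 2 * P^`()^`() + Q * H * jp * P^`() + V * P
    = lam *: (H ^+ 2 * jp * P) -> ('X - z%:P) ^+ j %| cpoly P.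
Proof.
move=> eP; rewrite -localize_dvd.
apply: (span_first_exponent eA eB eS A00 S00 b0E d0E); apply: pspan_gen.
by exists (lam%:C)%C; rewrite /eqop !deriv_localize -!localizeM -!localizeD eP localizeZ.
Qed.

(** This is [second_order_relation] expanded by the product rule, with the Taylor coefficients of
    [h] read off from the derivatives of [H], and the nonzero factor [h ^+ 2 * jp] at [z]
    cancelled. *)
Lemma second_order_at_root (kap := (j + k)%:R : K) (m := (k * k.+1)%:R / 2 : K)
    (ev := fun P => (cpoly P).[z]) :
  ev V^`() + kap * ev H^`() * ev jp * ev Q^`() - 2 * kap * ev jp^`() * ev H^`() ^+ 2 * ev jp
  - kap * ev jp ^+ 2 * ev H^`() * ev H^`()^`() + 3 * ev jp * ev jp^`() * m * ev H^`() ^+ 2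
  + 2 * ev jp ^+ 2 * m * ev H^`() * ev H^`()^`() = 0.
Proof.
have [h' [eh' _ h2]] := reduced_localize zrs.
have h0' : h.[0] = ev H^`() by [].
have {h' eh'}h2 : 2 * h^`().[0] = ev H^`()^`().
  by rewrite /ev -h2; congr (2 * _^`().[0]); apply: (mulfI (negbT (polyX_eq0 _))); rewrite -eh eh'.
have := second_order_relation exz eA eB eS A00 S00 b0E d0E; rewrite d0E b0E.
rewrite -/kap -/m -/(ev _) /A0 /B0 /S0 !(derivM, deriv_exp) /= !deriv_localize.
rewrite !(hornerD, hornerM, horner_exp, hornerMn) !localize0.
rewrite -/(ev _).
have qz : ev Q = - (2 * j + 2 * k)%:R * (h.[0] * ev jp).
  by case/andP: ejk => /eqP + _; rewrite /= cpolyM hornerM -h0.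
rewrite -!/(ev _) -h2 -h0' qz /m.
set x := h.[0]; set y := h^`().[0]; move=> e.
have nz : x ^+ 2 * ev jp != 0 by rewrite mulf_neq0 ?expf_neq0 // /ev -localize0.
apply: (mulfI nz); rewrite mulr0; apply/eqP; move/eqP: e; rewrite -subr_eq0; congr (_ == _).
by rewrite /kap; field.
Qed.

End AtRoot.

(** At a zero of [jp] the denominator vanishes to first order only, so orders drop by 1 and the
    least natural exponent bounds the order of every eigenpolynomial. *)
Lemma exists_endpoint_exponent z (ev := fun P => (cpoly P).[z]) : ev jp = 0 -> exists a : nat,
  (ev jp^`() * ev H) ^+ 2 * (a%:R * (a%:R - 1)) + ev Q * ev H * ev jp^`() * a%:R + ev V = 0 /\
  forall P lam, H ^+ 2 * jp ^+ 2 * P^`()^`() + Q * H * jp * P^`() + V * P = lam *: (H ^+ 2 * jp * P) ->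
    ('X - z%:P) ^+ a %| cpoly P.
Proof.
move=> pz; have [ph [eph ph0 _]] := localize_root pz.
have zrs : z \notin rs by apply: contraTN isT => zrs; have := reduced_jp_neq0 zrs; rewrite -/(ev _) pz eqxx.
have Hz : (localize z H).[0] != 0 by rewrite localize0 eH horner_rootprod_neq0.
have ph00 : ph.[0] != 0.
  rewrite ph0 deriv_jp cpolyD cpolyX hornerD hornerX -mulr2n mulrn_eq0 /=.
  move: pz; rewrite /ev => /eqP; rewrite cpoly_jp_eq0 => /orP[] /eqP ->; by rewrite ?oppr_eq0 oner_eq0.
have eA : localize z (H ^+ 2 * jp ^+ 2) = 'X^2 * (localize z H ^+ 2 * ph ^+ 2).
  by rewrite localizeM !localizeE eph; ring.
have eB : localize z (Q * H * jp) = 'X * (localize z Q * localize z H * ph).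
  by rewrite !localizeM eph; ring.
have eS : localize z (H ^+ 2 * jp) = 'X^1 * (localize z H ^+ 2 * ph).
  by rewrite localizeM !localizeE eph; ring.
have S00 : (localize z H ^+ 2 * ph).[0] != 0 by rewrite hornerM horner_exp mulf_neq0 ?expf_neq0.
have [a [ea da]] := exists_min_exponent (exceptional_localize z ex) eA eB eS S00 isT.
exists a; split.
  move: ea; rewrite /indicial !(hornerM, horner_exp) !localize0 ph0 => <-; rewrite /ev; ring.
move=> P lam eP; rewrite -localize_dvd; apply/da/pspan_gen.
by exists (lam%:C)%C; rewrite /eqop !deriv_localize -!localizeM -!localizeD eP localizeZ.
Qed.

Lemma real_logderiv P m : cpoly P = rootprod rs m -> exists t,
  [/\ P^`() * H = P * t, (size t < size H)%N &
      forall z, z \in rs -> (cpoly t).[z] = (m z)%:R * (cpoly H^`()).[z]].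
Proof.
move=> eP; have [tC [etC tz]] := rootprod_logderiv m urs.
have P0 : P != 0 by rewrite -cpoly_eq0 eP rootprod_neq0.
have /dvdpP[t et] : P %| P^`() * H.
  by rewrite -cpoly_dvd cpolyM -deriv_cpoly eP eH etC dvdp_mulr.
have ct : cpoly t = tC.
  have cP0 : cpoly P != 0 by rewrite cpoly_eq0.
  by apply: (mulfI cP0); rewrite -cpolyM [P * t]mulrC -et cpolyM -deriv_cpoly eP eH etC.
exists t; split; [by rewrite et mulrC | | by move=> z zrs; rewrite ct tz // -deriv_cpoly eH].
have [->|t0] := eqVneq t 0; first by rewrite size_poly0 size_poly_gt0.
have dP0 : P^`() != 0 by apply: contra_eq_neq et => ->; rewrite mul0r eq_sym mulf_neq0.
have := congr1 (fun p : {poly R} => size p) et; rewrite !size_mul // => e.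
have lt := lt_size_deriv P0.
have nat1 x y u w : (x < y)%N -> (x + u).-1 = (w + y).-1 -> (0 < u)%N -> (w < u)%N by lia.
by apply: nat1 lt e _; rewrite size_poly_gt0.
Qed.

(** * The gauge factor and the remaining coefficients *)

Section GaugeData.
Variables (jk : K -> nat * nat) (tau kp t v : {poly R}) (a b : nat).
Hypothesis hjk : forall z, z \in rs -> is_exponent z (jk z).
Let kap z := ((jk z).1 + (jk z).2)%N.
Let mul z := ((jk z).2 * (jk z).2.+1)./2.
Hypotheses (size_t : (size t < size H)%N) (size_v : (size v < size H)%N).
Hypothesis tz : forall z, z \in rs -> (cpoly t).[z] = (mul z)%:R * (cpoly H^`()).[z].
Hypothesis vz : forall z, z \in rs -> (cpoly v).[z] = (kap z)%:R * (cpoly H^`()).[z].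
Let endpoint_exponent z (a : nat) (ev := fun P => (cpoly P).[z]) := 
  (ev jp^`() * ev H) ^+ 2 * (a%:R * (a%:R - 1)) + ev Q * ev H * ev jp^`() * a%:R + ev V = 0.
Hypotheses (ea : endpoint_exponent 1 a) (eb : endpoint_exponent (-1) b).

(* [gauge_num / (H * jp)] is the logarithmic derivative of [1 / (kp (x - 1)^a (x + 1)^b)] when [v / H] is
   that of [kp]. *)
Definition gauge_num := - (v * jp) - H * (a%:R *: ('X + 1) + b%:R *: ('X - 1)).
Let w := gauge_num.

Definition defect_num := defect jp H Q V w t.

Lemma size_gauge_num : (size w <= size H + 1)%N.
Proof.
have nat1 x y : (x < y)%N -> ((x + 3).-1 <= y + 1)%N by lia.
have nat2 y : (0 < y)%N -> ((y + 2).-1 <= y + 1)%N by lia.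
rewrite /w /gauge_num; apply: leq_trans (size_polyD _ _) _; rewrite geq_max !size_polyN; apply/andP; split.
  by apply: leq_trans (size_polyMleq _ _) _; rewrite size_jp; apply: nat1.
apply: leq_trans (size_polyMleq _ _) _.
apply: leq_trans (nat2 _ _); last by rewrite size_poly_gt0.
rewrite -!subn1 leq_sub2r // leq_add2l; apply: leq_trans (size_polyD _ _) _; rewrite geq_max.
rewrite !(leq_trans (size_scale_leq _ _)) //; first by rewrite -polyC1 size_XsubC.
by rewrite -polyC1 size_XaddC.
Qed.

Lemma gauge_num_endpoint z : (cpoly jp).[z] = 0 ->
  (cpoly w).[z] = - ((cpoly H).[z] * (a%:R * (z + 1) + b%:R * (z - 1))).
Proof.
move=> pz; have lin (n : nat) (x : R) : (cpoly (n%:R *: ('X + x%:P))).[z] = n%:R * (z + (x%:C)%C).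
  by rewrite -mul_polyC cpolyM cpolyD cpolyX !cpolyC !(hornerM, hornerD, hornerX, hornerC) rmorph_nat.
rewrite /w /gauge_num cpolyD !cpolyN !cpolyM !(hornerD, hornerN, hornerM) pz mulr0 oppr0 add0r.
by rewrite cpolyD hornerD -polyC1 -polyCN !lin rmorphN rmorph1.
Qed.

Lemma gauge_num_root z : z \in rs ->
  (cpoly w).[z] = - (kap z)%:R * (cpoly H^`()).[z] * (cpoly jp).[z].
Proof.
move=> zrs; have Hz : (cpoly H).[z] = 0 by rewrite eH root_rootprod1.
by rewrite /w /gauge_num cpolyD !cpolyN !cpolyM !(hornerD, hornerN, hornerM) Hz vz //; ring.
Qed.

Lemma exponent_root z : z \in rs ->
  (cpoly Q).[z] = - (2 * (kap z)%:R) * (cpoly H^`()).[z] * (cpoly jp).[z].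
Proof.
by move=> zrs; have /andP[/eqP -> _] := hjk zrs; rewrite cpolyM hornerM /kap; ring.
Qed.

(** The values of [Q] and [2 w] agree on [rs], so [H] divides the difference, and the growth at
    infinity makes the quotient affine. It becomes [jp] times [eta]. *)
Lemma linear_part : exists l, Q = w + w + H * l /\ (size l <= 2)%N.
Proof.
have /dvdpP[l el] : H %| Q - (w + w).
  rewrite -cpoly_dvd eH; apply: rootprod_dvd => // z zrs; rewrite expr1 dvdp_XsubCl rootE.
  rewrite cpolyD cpolyN cpolyD !(hornerD, hornerN) gauge_num_root // exponent_root //.
  by apply/eqP; ring.
exists l; split; first by rewrite mulrC -el; ring.
have sw := size_gauge_num; have /andP[sQ _] := reduced_sizes.
have [->|l0] := eqVneq l 0; first by rewrite size_poly0.
have : (size (l * H)%R <= size H + 1)%N.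
  rewrite -el; apply: leq_trans (size_polyD _ _) _; rewrite geq_max sQ size_polyN.
  by apply: leq_trans (size_polyD _ _) _; rewrite geq_max sw.
rewrite size_mul //.
have nat1 x y : (0 < x)%N -> ((x + y).-1 <= y + 1)%N -> (x <= 2)%N by lia.
by apply: nat1; rewrite size_poly_gt0.
Qed.

Lemma mul_half z : ((mul z)%:R : K) = ((jk z).2 * (jk z).2.+1)%:R / 2.
Proof.
have e : ((jk z).2 * (jk z).2.+1)%N = (mul z * 2)%N.
  by rewrite /mul muln2 even_halfK // oddM /= andbN.
by rewrite e natrM mulfK ?pnatr_eq0.
Qed.

Lemma defect_num_root z : z \in rs -> ('X - z%:P) ^+ 2 %| cpoly defect_num.
Proof.
move=> zrs; pose ev P := (cpoly P).[z].
have ek : is_exponent z ((jk z).1, (jk z).2) by rewrite -surjective_pairing hjk.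
have [h [eh h0 _]] := reduced_localize zrs.
have so := second_order_at_root zrs eh h0 ek; cbv zeta in so.
apply: (@defect_double_root _ _ _ _ _ _ _ (kap z) (((jk z).2 * (jk z).2.+1)%:R / 2) _ _ _ _ _ so).
- by rewrite eH root_rootprod1.
- exact: exponent_root.
- exact: gauge_num_root.
- by rewrite tz // mul_half.
(* With [kap = j + k] and [m = k (k + 1) / 2] the factor [kap^2 + kap - 2 m] equals
   [j (j + 2 k + 1)]. *)
case/andP: ek => _ /eqP; rewrite /= cpolyE cpolyM horner_exp hornerM => ->.
by rewrite /kap; field.
Qed.

(** Double zeros on [rs] and zeros at 1 and -1 make [H ^+ 2 * jp] a divisor; the degree bound leaves
    only a constant quotient. *)
Lemma defect_num_const : exists c, defect_num = c *: (H ^+ 2 * jp).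
Proof.
have jp1 z : (z == 1) || (z == -1) -> (cpoly jp).[z] = 0.
  by move=> ez; apply/eqP; rewrite cpoly_jp_eq0.
have dv1 : 'X - 1%:P %| cpoly defect_num.
  apply: (@defect_simple_root _ _ _ _ _ _ _ a%:R _ _ ea); first by rewrite jp1 ?eqxx.
  by rewrite /w gauge_num_endpoint ?jp1 ?eqxx // horner_deriv_jp; ring.
have dvN1 : 'X - (-1)%:P %| cpoly defect_num.
  apply: (@defect_simple_root _ _ _ _ _ _ _ b%:R _ _ eb); first by rewrite jp1 ?eqxx ?orbT.
  by rewrite /w gauge_num_endpoint ?jp1 ?eqxx ?orbT // horner_deriv_jp; ring.
have dvH : cpoly (H ^+ 2) %| cpoly defect_num.
  have -> : cpoly (H ^+ 2) = rootprod rs (fun=> 2%N).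
    by rewrite cpolyE eH /rootprod -prodrXl; apply: eq_bigr => z _; rewrite expr1.
  by apply: rootprod_dvd => // z zrs; apply: defect_num_root.
have n2 : (1 - (-1) : K) != 0 by rewrite opprK (pnatr_eq0 _ 2).
have /dvdpP[c ec] : H ^+ 2 * jp %| defect_num.
  rewrite -cpoly_dvd cpolyM Gauss_dvdp ?dvH /=.
    by rewrite cpoly_jp Gauss_dvdp ?dv1 ?dvN1 // coprimep_XsubC2 // -opprB oppr_eq0.
  rewrite cpolyE coprimep_expl // cpoly_jp coprimepMr !coprimep_XsubC !rootE eH.
  by rewrite !horner_rootprod_neq0.
suff sc : (size c <= 1)%N.
  by exists c`_0; rewrite ec {1}(size1_polyC sc) mul_polyC.
have sw := size_gauge_num; have /andP[sQ sV] := reduced_sizes.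
have [->|c0] := eqVneq c 0; first by rewrite size_poly0.
suff : (size defect_num <= 2 * size H + 1)%N.
  rewrite ec !size_mul ?mulf_neq0 ?jp_neq0 // size_jp.
  have nat1 x y : (0 < y)%N -> (0 < x)%N -> ((x + ((y + y).-1 + 3).-1).-1 <= 2 * y + 1)%N -> (x <= 1)%N by lia.
  by apply: nat1; rewrite size_poly_gt0.
have [s es] : exists s, size H = s.+1 by exists (size H).-1; rewrite prednK ?size_poly_gt0.
rewrite es addn1 in sw sQ; rewrite es in sV *; rewrite /defect_num.
by apply: size_defect; rewrite ?size_jp // -ltnS -es.
Qed.

Hypotheses (etau : cpoly tau = rootprod rs mul) (ekp : cpoly kp = rootprod rs kap).
Variable P : {poly R}.
Hypotheses (dP : forall z, z \in rs -> ('X - z%:P) ^+ (jk z).1 %| cpoly P)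
  (dP1 : ('X - 1%:P) ^+ a %| cpoly P) (dPN1 : ('X - (-1)%:P) ^+ b %| cpoly P).

(** This makes the gauged eigenpolynomial a polynomial: at [z] the order of [tau * P] is at least
    [k (k + 1) / 2 + j], hence at least [j + k]. *)
Lemma gauge_dvd : kp * ('X - 1) ^+ a * ('X + 1) ^+ b %| tau * P.
Proof.
have c1 : cpoly ('X - 1 : {poly R}) = 'X - 1%:P by rewrite /cpoly rmorphB rmorph1 /= map_polyX.
have cN1 : cpoly ('X + 1 : {poly R}) = 'X - (-1)%:P by rewrite /cpoly rmorphD rmorph1 /= map_polyX polyCN opprK.
have n2 : (1 - (-1) : K) != 0 by rewrite opprK (pnatr_eq0 _ 2).
rewrite -cpoly_dvd !cpolyM !cpolyE c1 cN1 ekp Gauss_dvdp; last first.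
  rewrite coprimep_expr // coprimepMl coprimep_XsubC rootE horner_rootprod_neq0 //=.
  by rewrite coprimep_expl // coprimep_XsubC2 // -opprB oppr_eq0.
rewrite (dvdp_mull _ dPN1) andbT Gauss_dvdp; last first.
  by rewrite coprimep_expr // coprimep_XsubC rootE horner_rootprod_neq0.
rewrite (dvdp_mull _ dP1) andbT; apply: rootprod_dvd => // z zrs.
have le : (kap z <= mul z + (jk z).1)%N.
  by rewrite /kap /mul addnC leq_add2r leq_triangular.
apply: dvdp_trans (dvdp_exp2l _ le) _; rewrite exprD dvdp_mul ?dP // etau.
by rewrite /rootprod (big_rem z) //= dvdp_mulr.
Qed.
End GaugeData.

Lemma natural_gauge : exists (tau kp t v l : {poly R}) (a b : nat) (c : R)
    (w := - (v * jp) - H * (a%:R *: ('X + 1) + b%:R *: ('X - 1))),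
  [/\ [/\ tau.[1] != 0, tau.[-1] != 0 & kp != 0], tau^`() * H = tau * t /\ kp^`() * H = kp * v,
     Q = w + w + H * l /\ (size l <= 2)%N, defect jp H Q V w t = c *: (H ^+ 2 * jp) &
     forall P lam, H ^+ 2 * jp ^+ 2 * P^`()^`() + Q * H * jp * P^`() + V * P = lam *: (H ^+ 2 * jp * P) ->
       kp * ('X - 1) ^+ a * ('X + 1) ^+ b %| tau * P].
Proof.
have [jk [hjk cjk]] : exists jk : K -> nat * nat,
    (forall z, z \in rs -> is_exponent z (jk z)) /\ conj_invariant jk.
  apply: conj_choice => [z zrs|z jk].
    by have [h [eh h0 _]] := reduced_localize zrs; apply: (exists_is_exponent zrs eh h0).
  (* Integers are fixed by conjugation and the polynomials are real, so the conditions at [z] and at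
     its conjugate are equivalent. *)
  have natJ n : (n%:R : K) = conjc n%:R by rewrite conjc_nat.
  rewrite /is_exponent !conj_horner_cpoly [in LHS](natJ (_ + _)%N) [in LHS](natJ (_ * _)%N).
  by rewrite -rmorphN -!rmorphM !(inj_eq (inv_inj (@conjcK R))).
pose mul z := ((jk z).2 * (jk z).2.+1)./2.
pose kap z := ((jk z).1 + (jk z).2)%N.
have [tau etau] : exists P, cpoly P = rootprod rs mul.
  by apply: real_rootprod => // z; rewrite /mul cjk.
have [kp ekp] : exists P, cpoly P = rootprod rs kap.
  by apply: real_rootprod => // z; rewrite /kap cjk.
have [t [et st tz]] := real_logderiv etau.
have [v [ev sv vz]] := real_logderiv ekp.
have jp1 z : (z == 1) || (z == -1) -> (cpoly jp).[z] = 0.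
  by move=> ez; apply/eqP; rewrite cpoly_jp_eq0.
have [|a [ea da]] := @exists_endpoint_exponent 1; first by rewrite jp1 ?eqxx.
have [|b [eb db]] := @exists_endpoint_exponent (-1); first by rewrite jp1 ?eqxx ?orbT.
have [l [el sl]] := linear_part a b hjk st sv vz.
have [c ec] := defect_num_const hjk st sv tz vz ea eb.
have tau1 (x : R) : (x%:C)%C \notin rs -> tau.[x] != 0.
  by move=> xrs; rewrite -(inj_eq (@complexI R)) -horner_cpoly etau horner_rootprod_neq0.
exists tau, kp, t, v, l, a, b, c; split=> //.
  split; [exact: tau1| |by rewrite -cpoly_eq0 ekp rootprod_neq0].
  by apply: tau1; rewrite rmorphN.
move=> P lam eP; apply: (gauge_dvd etau ekp); [|exact: da eP|exact: db eP].
move=> z zrs; have [h [eh h0 _]] := reduced_localize zrs.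
have ek : is_exponent z ((jk z).1, (jk z).2) by rewrite -surjective_pairing hjk.
exact: (dvd_at_root zrs eh h0 ek eP).
Qed.

End Reduced.
End JacobiPolynomials.

(** * Rational functions *)

Section FieldIdentities.
Variable K : fieldType.
Implicit Types n d m e p q r s : K.

Lemma quotient_rule_mul n n' m m' d' e' d e : d != 0 -> e != 0 ->
  ((n' * m + n * m') * (d * e) - n * m * (d' * e + d * e')) / (d * e * (d * e)) =
  (n' * d - n * d') / (d * d) * (m / e) + n / d * ((m' * e - m * e') / (e * e)).
Proof. by move=> d0 e0; field; rewrite d0 e0. Qed.

Lemma quotient_rule_add n n' m m' d' e' d e : d != 0 -> e != 0 ->
  ((n' * e + n * e' + (m' * d + m * d')) * (d * e) - (n * e + m * d) * (d' * e + d * e')) / (d * e * (d * e)) =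
  (n' * d - n * d') / (d * d) + (m' * e - m * e') / (e * e).
Proof. by move=> d0 e0; field; rewrite d0 e0. Qed.

Lemma gauge_apply_id p q r s s' m y y' y'' :
  p * ((s' * m + s * (s * m)) * y + s * m * y' + (s * m * y' + m * y'')) + (q - 2 * p * s) * (s * m * y + m * y')
  + (r - q * s + p * (s ^+ 2 - s')) * (m * y) = m * (p * y'' + q * y' + r * y).
Proof. by ring. Qed.

Lemma gauge_coef1 (p H Q om l g : K) : H != 0 ->
  Q = H * p * om + H * p * om + H * l ->
  Q / H - 2 * p * (g + om) = - (2 * p * g) + l.
Proof. by move=> H0 ->; field. Qed.

(** Here [g] and [om] stand for [t / H] and [w / (H * p)], and [dg], [dom] for their derivatives.
    The hypothesis on the defect is solved for [V]. *)
Lemma gauge_coef0 (p dp H dH Q V om dom l g dg c : K)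
   (w := H * p * om) (dw := dom * (H * p) + om * (dH * p + H * dp)) (t := g * H) (dt := dg * H + g * dH) :
  p != 0 -> H != 0 ->  Q = w + w + H * l ->
  V + w * w - Q * w - p * (dw * H - w * dH) + dp * w * H
  - (p * p * (dt * H - t * dH) + p * p * (dt * H - t * dH)) - p * dp * t * H = c * (H ^+ 2 * p) ->
  V / (H ^+ 2 * p) - Q / H * (g + om) + p * ((g + om) ^+ 2 - (dg + dom)) - c
  = p * (dg + g ^+ 2) - l * g + dp * g.
Proof.
move=> p0 H0 eQ e; have Hp : H ^+ 2 * p != 0 by rewrite mulf_neq0 ?expf_neq0.
have -> : V = (c + p * (om ^+ 2 + dom + 2 * dg) + l * om + dp * g) * (H ^+ 2 * p).
  transitivity (c * (H ^+ 2 * p) - (w * w - Q * w - p * (dw * H - w * dH) + dp * w * H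
  - (p * p * (dt * H - t * dH) + p * p * (dt * H - t * dH)) - p * dp * t * H)).
    by rewrite -e; ring.
  by rewrite eQ /w /dw /t /dt; ring.
have -> : Q = (2 * p * om + l) * H by rewrite eQ /w; ring.
by rewrite !mulfK //; ring.
Qed.

Lemma logderiv2_id s' s m : m != 0 -> (s' * m + s * (s * m)) / m = s' + s ^+ 2.
Proof. by move=> m0; field. Qed.

Lemma eta_id p x A B : x - 1 != 0 -> x + 1 != 0 -> p = x ^+ 2 - 1 ->
  p * (A / (x - 1) + B / (x + 1)) = A * (x + 1) + B * (x - 1).
Proof. by move=> h1 h2 ->; field; rewrite h1 h2. Qed.

Lemma Tng_coef1_id p g e l : p * e = l ->
  p * (0 + - (2 * g) * 1 + 0 + e * (1 + 0)) + 0 = - (2 * p * g) + l.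
Proof. by move=> <-; ring. Qed.

Lemma Tng_coef0_id p g dg e l x dp : p * e = l -> dp = 2 * x ->
  p * (0 + - (2 * g) * 0 + (dg + g ^+ 2) + e * (0 + - g)) + 2 * x * g = p * (dg + g ^+ 2) - l * g + dp * g.
Proof. by move=> <- ->; ring. Qed.

Lemma clear_den_id p q r s y y' y'' Q V : q * s = Q -> r * s = V ->
  s * p * y'' + Q * y' + V * y = s * (p * y'' + q * y' + r * y).
Proof. by move=> <- <-; ring. Qed.

Lemma gauge_logder_id tau D H p t w dtau dD : tau != 0 -> D != 0 -> H != 0 -> p != 0 ->
  dtau * H = tau * t -> dD * (H * p) = - (D * w) ->
  (dtau * D - tau * dD) / (D * D) = (t / H + w / (H * p)) * (tau / D).
Proof.
move=> t0 D0 H0 p0 e1 e2.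
have -> : dtau = tau * t / H by rewrite -e1 mulfK.
have -> : dD = - (D * w) / (H * p) by rewrite -e2 mulfK ?mulf_neq0.
by field; rewrite D0 H0 p0.
Qed.

Lemma eq_quotient x s n h q : s != 0 -> h != 0 -> x * s = n -> n * h = s * q -> x = q / h.
Proof.
move=> s0 h0 e1 e2; apply: (mulIf h0); rewrite divfK //; apply: (mulfI s0).
by rewrite -e2 -e1; ring.
Qed.

End FieldIdentities.

Section RationalFunctions.
Variable R : realType.
Notation rf := {fraction {poly R}}.
Implicit Types (x y : rf) (P Q n d : {poly R}).

Lemma fraction_repr x : x * rpoly \d_(repr x) = rpoly \n_(repr x).
Proof.
rewrite /rpoly -{1}[x]reprK; move: (repr x) => y; rewrite !piE; apply/eqmodP.
rewrite /= FracField.equivfE /FracField.mulf /= !numden_Ratio ?mulf_neq0 ?denom_ratioP ?oner_eq0 //.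
by rewrite !mulr1 mulrC.
Qed.

Lemma rpoly_inj : injective (@rpoly R).
Proof. by move=> P Q /eqP; rewrite tofrac_eq => /eqP. Qed.

Lemma rpolyD P Q : rpoly (P + Q) = rpoly P + rpoly Q. Proof. exact: tofracD. Qed.
Lemma rpolyM P Q : rpoly (P * Q) = rpoly P * rpoly Q. Proof. exact: tofracM. Qed.
Lemma rpolyN P : rpoly (- P) = - rpoly P. Proof. exact: tofracN. Qed.
Lemma rpolyXn P k : rpoly (P ^+ k) = rpoly P ^+ k. Proof. exact: tofracXn. Qed.
Lemma rpoly1 : rpoly 1 = 1 :> rf. Proof. exact: tofrac1. Qed.
Lemma rpoly_eq0 P : (rpoly P == 0) = (P == 0). Proof. exact: tofrac_eq0. Qed.

(** [rderiv] uses a chosen representative; differentiating the cross product [n * d1 = n1 * d] shows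
    that any other fraction gives the same result. *)
Lemma rderiv_frac n d : d != 0 -> rderiv (rpoly n / rpoly d) = rpoly (n^`() * d - n * d^`()) / rpoly (d * d).
Proof.
move=> d0; set x := rpoly n / rpoly d; rewrite /rderiv.
have := fraction_repr x; set n1 := \n_(repr x); set d1 := \d_(repr x) => e.
have d10 : d1 != 0 by apply: denom_ratioP.
have rd0 : rpoly d != 0 by rewrite rpoly_eq0.
have e1 : n * d1 = n1 * d.
  by apply: rpoly_inj; rewrite !rpolyM -e /x [RHS]mulrAC divfK.
apply/eqP; rewrite eqr_div ?rpoly_eq0 ?mulf_neq0 // -!rpolyM; apply/eqP; congr rpoly.
have e2 := congr1 (@deriv _) e1; rewrite !derivM in e2.
have -> : (n1^`() * d1 - n1 * d1^`()) * (d * d) = (n1^`() * d + n1 * d^`()) * d1 * d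
  - n1 * d * d^`() * d1 - n1 * d * d1^`() * d by ring.
by rewrite -e2 -e1; ring.
Qed.

Lemma fraction_ex x : exists n d, d != 0 /\ x = rpoly n / rpoly d.
Proof.
exists \n_(repr x), \d_(repr x); have d0 := denom_ratioP (repr x); split=> //.
by rewrite -fraction_repr mulfK // rpoly_eq0.
Qed.

Lemma rderiv_rpoly P : rderiv (rpoly P) = rpoly P^`().
Proof.
have := rderiv_frac P (oner_neq0 _).
by rewrite -polyC1 derivC mulr0 subr0 polyC1 !mulr1 rpoly1 !divr1.
Qed.

Lemma rderivM x y : rderiv (x * y) = rderiv x * y + x * rderiv y.
Proof.
have [n [d [d0 ->]]] := fraction_ex x; have [m [e [e0 ->]]] := fraction_ex y.
have rd : rpoly d != 0 by rewrite rpoly_eq0.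
have re : rpoly e != 0 by rewrite rpoly_eq0.
have -> : rpoly n / rpoly d * (rpoly m / rpoly e) = rpoly (n * m) / rpoly (d * e).
  by rewrite !rpolyM mulf_div.
rewrite !rderiv_frac ?mulf_neq0 // !derivM !(rpolyD, rpolyN, rpolyM).
exact: (quotient_rule_mul (rpoly n) (rpoly n^`()) (rpoly m) (rpoly m^`()) (rpoly d^`()) (rpoly e^`()) rd re).
Qed.

Lemma rderivD x y : rderiv (x + y) = rderiv x + rderiv y.
Proof.
have [n [d [d0 ->]]] := fraction_ex x; have [m [e [e0 ->]]] := fraction_ex y.
have rd : rpoly d != 0 by rewrite rpoly_eq0.
have re : rpoly e != 0 by rewrite rpoly_eq0.
have -> : rpoly n / rpoly d + (rpoly m / rpoly e) = rpoly (n * e + m * d) / rpoly (d * e).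
  by rewrite (addf_div _ _ rd re) rpolyD !rpolyM.
rewrite !rderiv_frac ?mulf_neq0 // derivD !derivM !(rpolyD, rpolyN, rpolyM).
exact: (quotient_rule_add (rpoly n) (rpoly n^`()) (rpoly m) (rpoly m^`()) (rpoly d^`()) (rpoly e^`()) rd re).
Qed.

(** So [gauge_logder sigma T] is the conjugate of [T] by multiplication with [mu]; only the
    logarithmic derivative of [mu] enters the coefficients. *)
Lemma gauge_logder_apply (T : op R) (sigma mu y : rf) : rderiv mu = sigma * mu ->
  op_apply (gauge_logder sigma T) (mu * y) = mu * op_apply T y.
Proof.
move=> em; rewrite /op_apply /= (rderivM mu y) em rderivD (rderivM (sigma * mu) y).
rewrite (rderivM sigma mu) (rderivM mu (rderiv y)) em.
exact: (gauge_apply_id (opp2 T) (opp1 T) (opp0 T) sigma (rderiv sigma) mu y (rderiv y) (rderiv (rderiv y))).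
Qed.

Lemma op_shift_apply (T : op R) c y : op_apply (op_shift T c) y = op_apply T y + rpoly c%:P * y.
Proof. by rewrite /op_apply /= mulrDl !addrA. Qed.

Lemma rpoly_jp : rX R ^+ 2 - 1 = rpoly (jp R).
Proof. by rewrite /jp rpolyD rpolyN rpolyXn rpoly1. Qed.

Lemma rpoly_djp : rpoly (jp R)^`() = 2 * rX R.
Proof. by rewrite deriv_jp rpolyD mulr_natl mulr2n. Qed.

Lemma deriv_gauge_den (H kp v : {poly R}) (a b : nat)
    (D := kp * ('X - 1) ^+ a * ('X + 1) ^+ b) : kp^`() * H = kp * v ->
  D^`() * (H * jp R) = - (D * gauge_num H v a b).
Proof.
move=> ek.
have pw (c : R) (k : nat) : (('X + c%:P) ^+ k)^`() * ('X + c%:P) = k%:R *: ('X + c%:P) ^+ k.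
  rewrite deriv_exp derivD derivX derivC addr0 mul1r scaler_nat.
  by case: k => [|k]; rewrite ?mulr0n ?mul0r // mulrnAl -exprSr.
have := pw (-1) a; have := pw 1 b; rewrite polyCN polyC1.
set f := ('X + 1) ^+ b; set g := ('X - 1) ^+ a => ef eg.
have -> : D^`() * (H * jp R) = (kp^`() * H) * g * f * jp R + kp * H * (g^`() * ('X - 1)) * ('X + 1) * f
   + kp * H * (f^`() * ('X + 1)) * ('X - 1) * g.
  by rewrite /D -/f -/g /jp !derivM; ring.
by rewrite ek ef eg /gauge_num /D -/f -/g -!mul_polyC; ring.
Qed.

Lemma Tng_opp2 (tau : {poly R}) al be : opp2 (Tng tau al be) = rX R ^+ 2 - 1.
Proof. by rewrite /= !(add0r, addr0, mulr0, mulr1). Qed.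

(** With [g] the logarithmic derivative of [tau], the quotient of its second derivative by [tau] is
    [g' + g^2], and [jp] clears the denominators of [eta]. *)
Lemma Tng_E (tau H t : {poly R}) (al be : R) (g := rpoly t / rpoly H)
    (l := rpoly ((al + 1)%:P * ('X + 1) + (be + 1)%:P * ('X - 1))) :
  tau != 0 -> H != 0 -> tau^`() * H = tau * t ->
  Tng tau al be = Op (rX R ^+ 2 - 1) (- (2 * rpoly (jp R) * g) + l)
    (rpoly (jp R) * (rderiv g + g ^+ 2) - l * g + rpoly (jp R)^`() * g).
Proof.
move=> tau0 H0 et.
have rtau : rpoly tau != 0 by rewrite rpoly_eq0.
have rH : rpoly H != 0 by rewrite rpoly_eq0.
have dtau : rderiv (rpoly tau) = g * rpoly tau.
  by rewrite rderiv_rpoly /g mulrAC -rpolyM [t * tau]mulrC -et rpolyM mulfK.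
have eg : rderiv (rpoly tau) / rpoly tau = g by rewrite dtau (mulfK rtau).
have eh : rderiv (rderiv (rpoly tau)) / rpoly tau = rderiv g + g ^+ 2.
  by rewrite dtau rderivM dtau; exact: (logderiv2_id (rderiv g) g rtau).
have x1 : rX R - 1 != 0.
  by rewrite /rX -rpoly1 -rpolyN -rpolyD rpoly_eq0 -polyC1 polyXsubC_eq0.
have xN1 : rX R + 1 != 0.
  by rewrite /rX -rpoly1 -rpolyD rpoly_eq0 -polyC1 -size_poly_gt0 size_XaddC.
have el : rpoly (jp R) * Defs.eta al be = l.
  rewrite /Defs.eta (eta_id _ _ x1 xN1 (esym rpoly_jp)) /l rpolyD !rpolyM.
  by rewrite rpolyD rpolyD rpolyN rpoly1.
rewrite /Tng eg eh /op_add /op_lmul /= rpoly_jp; congr Op.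
- by rewrite !(add0r, addr0, mulr0, mulr1).
- exact: Tng_coef1_id.
exact: (Tng_coef0_id g (rderiv g) el rpoly_djp).
Qed.

End RationalFunctions.

(** * Gauge equivalence over the rational functions *)

Section MainTheorem.
Variable R : realType.
Implicit Types (T : op R) (P Q V S H w t l tau D : {poly R}).

Lemma clear_den T S Q V P lam :
  opp2 T = rpoly (jp R) -> opp1 T * rpoly S = rpoly Q -> opp0 T * rpoly S = rpoly V ->
  op_apply T (rpoly P) = rpoly (lam *: P) ->
  S * jp R * P^`()^`() + Q * P^`() + V * P = lam *: (S * P).
Proof.
move=> e2 e1 e0 eP; apply: rpoly_inj; rewrite scalerAr !rpolyD !rpolyM -eP /op_apply e2 !rderiv_rpoly.
exact: (clear_den_id _ _ _ _ e1 e0).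
Qed.

Lemma reduce_equation S Q V H Q1 V1 P lam : S != 0 -> Q * H = S * Q1 -> V * H ^+ 2 * jp R = S * V1 ->
  S * jp R * P^`()^`() + Q * P^`() + V * P = lam *: (S * P) ->
  H ^+ 2 * jp R ^+ 2 * P^`()^`() + Q1 * H * jp R * P^`() + V1 * P = lam *: (H ^+ 2 * jp R * P).
Proof.
move=> S0 eQ eV eP; apply: (mulfI S0).
transitivity (H ^+ 2 * jp R * (S * jp R * P^`()^`() + Q * P^`() + V * P)).
  have -> : H ^+ 2 * jp R * (S * jp R * P^`()^`() + Q * P^`() + V * P) =
    S * H ^+ 2 * jp R ^+ 2 * P^`()^`() + (Q * H) * H * jp R * P^`() + (V * H ^+ 2 * jp R) * P by ring.
  by rewrite eQ eV; ring.
by rewrite eP -!mul_polyC; ring.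
Qed.

Lemma rpoly_defect p H Q V w t : rpoly (defect p H Q V w t) =
  rpoly V + rpoly w * rpoly w - rpoly Q * rpoly w - rpoly p * (rpoly w^`() * rpoly H - rpoly w * rpoly H^`())
  + rpoly p^`() * rpoly w * rpoly H
  - (rpoly p * rpoly p * (rpoly t^`() * rpoly H - rpoly t * rpoly H^`())
     + rpoly p * rpoly p * (rpoly t^`() * rpoly H - rpoly t * rpoly H^`()))
  - rpoly p * rpoly p^`() * rpoly t * rpoly H.
Proof. by rewrite /defect !(rpolyD, rpolyN, rpolyM). Qed.

(** The first order coefficients agree by the decomposition of [Q], those of order zero by the
    equation for the defect, whose constant [c] is removed by the shift. *)
Lemma gauge_logder_Tng T H Q V tau t w l al be c :
  H != 0 -> tau != 0 -> opp2 T = rX R ^+ 2 - 1 -> opp1 T = rpoly Q / rpoly H ->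
  opp0 T = rpoly V / (rpoly H ^+ 2 * rpoly (jp R)) ->
  tau^`() * H = tau * t -> Q = w + w + H * l -> l = (al + 1)%:P * ('X + 1) + (be + 1)%:P * ('X - 1) ->
  defect (jp R) H Q V w t = c *: (H ^+ 2 * jp R) ->
  op_shift (gauge_logder (rpoly t / rpoly H + rpoly w / (rpoly H * rpoly (jp R))) T) (- c) = Tng tau al be.
Proof.
move=> H0 tau0 e2 e1 e0 et eQ el ec.
rewrite (Tng_E _ _ tau0 H0 et) -el /op_shift /gauge_logder /= e2 e1 e0 rpoly_jp.
set p := rpoly (jp R); set h := rpoly H; set g := rpoly t / h; set om := rpoly w / (h * p).
have p0 : p != 0 by rewrite rpoly_eq0 jp_neq0.
have h0 : h != 0 by rewrite rpoly_eq0.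
have hp0 : h * p != 0 := mulf_neq0 h0 p0.
have ew : rpoly w = h * p * om by rewrite /om [RHS]mulrC (divfK hp0).
have etg : rpoly t = g * h by rewrite /g (divfK h0).
have edw : rpoly w^`() = rderiv om * (h * p) + om * (rpoly H^`() * p + h * rpoly (jp R)^`()).
  by rewrite -rderiv_rpoly ew [h * p * om]mulrC !rderivM /h /p !rderiv_rpoly.
have edt : rpoly t^`() = rderiv g * h + g * rpoly H^`().
  by rewrite -rderiv_rpoly etg rderivM /h rderiv_rpoly.
have eQ' : rpoly Q = h * p * om + h * p * om + h * rpoly l.
  by rewrite eQ !rpolyD rpolyM ew.
have ec' : rpoly (defect (jp R) H Q V w t) = rpoly c%:P * (h ^+ 2 * p).
  by rewrite ec -mul_polyC rpolyM (rpolyM (H ^+ 2)) rpolyXn.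
rewrite rpoly_defect ew edw etg edt -/h -/p in ec'.
congr Op; first exact: (gauge_coef1 _ h0 eQ').
rewrite rderivD polyCN rpolyN.
exact: (gauge_coef0 p0 h0 eQ' ec').
Qed.

(** Multiplication by [tau / D] sends eigenpolynomials to eigenpolynomials and shifts all degrees by
    the same integer. *)
Lemma exceptional_gauge T (F : seq nat) tau D sigma c :
  (forall n, n \notin F -> exists (P : {poly R}) (lam : R),
      P != 0 /\ size P = n.+1 /\ op_apply T (rpoly P) = rpoly (lam *: P) /\ D %| tau * P) ->
  tau != 0 -> D != 0 -> rderiv (rpoly tau / rpoly D) = sigma * (rpoly tau / rpoly D) ->
  exceptional (op_shift (gauge_logder sigma T) c).
Proof.
move=> ex tau0 D0 emu.
(* Besides the shifted elements of [F], degrees below [size tau] are excluded, which keeps the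
   truncated subtractions exact. *)
exists (iota 0 (size tau) ++ [seq (n + size tau - size D)%N | n <- F]) => N.
rewrite mem_cat mem_iota add0n leq0n /= negb_or -leqNgt => /andP[leN nF].
have [|P [lam [P0 [sP [eP /dvdpP[Y eY]]]]]] := ex (N + size D - size tau)%N.
  apply: contraNN nF => inF; apply/mapP; eexists; first exact: inF.
  by rewrite subnK ?addnK // (leq_trans leN) // leq_addr.
have Y0 : Y != 0 by apply: contra_eq_neq eY => ->; rewrite mul0r mulf_neq0.
exists Y, (lam + c); split=> //; split.
  have := congr1 (fun p : {poly R} => size p) eY; rewrite !size_mul // sP.
  have : (0 < size D)%N by rewrite size_poly_gt0.
  have : (0 < size tau)%N by rewrite size_poly_gt0.
  move: leN; move: (size D) (size tau) (size Y) => x y u; lia.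
have rD : rpoly D != 0 by rewrite rpoly_eq0.
have eYr : rpoly Y = rpoly tau / rpoly D * rpoly P.
  by rewrite mulrAC -rpolyM eY rpolyM (mulfK rD).
rewrite op_shift_apply {1}eYr (gauge_logder_apply _ _ emu) eP -!mul_polyC rpolyM mulrCA -eYr.
by rewrite polyCD mulrDl rpolyD !rpolyM.
Qed.

End MainTheorem.

Theorem mainTheorem1 (R : realType) (T : op R) :
  exceptional_jacobi T ->
  exists (tau : {poly R}) (alpha beta c : R) (sigma : {fraction {poly R}}),
    tau.[1] != 0 /\ tau.[-1] != 0 /\
    op_shift (gauge_logder sigma T) c = Tng tau alpha beta /\
    exceptional_jacobi (Tng tau alpha beta).
Proof.
move=> [e2 [F exF]].
have [nq [dq [dq0 eq]]] := fraction_ex (opp1 T).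
have [nr [dr [dr0 er]]] := fraction_ex (opp0 T).
have rdq : rpoly dq != 0 by rewrite rpoly_eq0.
have rdr : rpoly dr != 0 by rewrite rpoly_eq0.
pose S := dq * dr; have S0 : S != 0 by rewrite mulf_neq0.
have rS : rpoly S != 0 by rewrite rpoly_eq0.
have e1S : opp1 T * rpoly S = rpoly (nq * dr) by rewrite eq !rpolyM mulrA (divfK rdq).
have e0S : opp0 T * rpoly S = rpoly (nr * dq).
  by rewrite er /S [dq * dr]mulrC !rpolyM mulrA (divfK rdr).
have clear P lam := clear_den (P := P) (lam := lam) (etrans e2 (rpoly_jp R)) e1S e0S.
have ex1 : poly_exceptional (S * jp R) (nq * dr) (nr * dq) S F.
  by move=> n /exF[P [lam [_ [sP /clear eP]]]]; exists P, lam.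
have [rs [H [Q [V [[urs crs rs1 rsN1] eH eQ eV]]]]] := simple_poles S0 ex1.
have ex2 : poly_exceptional (H ^+ 2 * jp R ^+ 2) (Q * H * jp R) V (H ^+ 2 * jp R) F.
  move=> n /ex1[P [lam [sP eP]]]; exists P, lam; split=> //.
  exact: reduce_equation S0 eQ eV eP.
have H0 := reduced_neq0 eH.
have [tau [kp [t [v [l [a [b [c [[tau1 tauN1 kp0] [et ev] [eQl sl] ec dvP]]]]]]]]] :=
  natural_gauge urs crs rs1 rsN1 eH ex2.
have [w ew] : exists w, w = gauge_num H v a b by eexists.
rewrite -/(gauge_num H v a b) -ew in eQl ec.
have rH : rpoly H != 0 by rewrite rpoly_eq0.
have rp : rpoly (jp R) != 0 by rewrite rpoly_eq0 jp_neq0.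
have tau0 : tau != 0 by apply: contraNneq tau1 => ->; rewrite horner0.
have e1 : opp1 T = rpoly Q / rpoly H.
  by apply: (eq_quotient rS rH e1S); rewrite -!rpolyM eQ.
have rHp : rpoly H ^+ 2 * rpoly (jp R) != 0 := mulf_neq0 (expf_neq0 2 rH) rp.
have e0 : opp0 T = rpoly V / (rpoly H ^+ 2 * rpoly (jp R)).
  by apply: (eq_quotient rS rHp e0S); rewrite -rpolyXn -!rpolyM mulrA eV.
(* The parameters solve [(alpha + 1)(x + 1) + (beta + 1)(x - 1) = l] coefficientwise. *)
have el : l = ((l`_1 + l`_0) / 2 - 1 + 1)%:P * ('X + 1) + ((l`_1 - l`_0) / 2 - 1 + 1)%:P * ('X - 1).
  apply/polyP => i; rewrite !subrK !mulrDr -polyC1 -polyCN -!polyCM !coefD !coefMX !coefC.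
  case: i => [|[|i]] /=; [by field|by field|].
  by rewrite !addr0 nth_default // (leq_trans sl).
set sigma := rpoly t / rpoly H + rpoly w / (rpoly H * rpoly (jp R)).
have eT := gauge_logder_Tng H0 tau0 e2 e1 e0 et eQl el ec.
exists tau, ((l`_1 + l`_0) / 2 - 1), ((l`_1 - l`_0) / 2 - 1), (- c), sigma.
do 3!split=> //; split; first exact: Tng_opp2.
(* Exceptionality is transported from [T] along the gauge by [tau / D], whose logarithmic derivative
   is [sigma]. *)
rewrite -eT; have eD := deriv_gauge_den a b ev; rewrite -ew in eD.
have [D defD] : exists D, D = kp * ('X - 1) ^+ a * ('X + 1) ^+ b by eexists.
rewrite -defD in dvP eD.
have D0 : D != 0.
  by rewrite defD !mulf_neq0 ?expf_neq0 // -polyC1 -size_poly_gt0 ?size_XaddC ?size_XsubC.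
apply: (@exceptional_gauge _ _ F tau D) => //.
  move=> n nF; have [P [lam [P0 [sP eP]]]] := exF n nF; exists P, lam; do 3!split=> //.
  exact: dvP P lam (reduce_equation S0 eQ eV (clear _ _ eP)).
have rtau : rpoly tau != 0 by rewrite rpoly_eq0.
have rD : rpoly D != 0 by rewrite rpoly_eq0.
rewrite (rderiv_frac _ D0) rpolyD rpolyN !rpolyM.
apply: (gauge_logder_id rtau rD rH rp); first by rewrite -!rpolyM et.
by rewrite -!rpolyM -rpolyN eD.
Qed.
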